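(* The following decision problem belongs to the complexity class $\mathcal{NP}$. Input: a positive integer $n$ and a skew-symmetrizable matrix $B\in \mathrm{M}_n(\mathbb{Z})$. Question: does $B$ have a positive quasi-Cartan companion?
   Context: A matrix $B\in \mathrm{M}_n(\mathbb{Z})$ is skew-symmetrizable if there is a diagonal matrix $D\in \mathrm{M}_n(\mathbb{Q})$ with positive diagonal entries such that $DB$ is skew-symmetric. A matrix $C\in \mathrm{M}_n(\mathbb{Z})$ is symmetrizable if there is a diagonal matrix $D\in \mathrm{M}_n(\mathbb{Q})$ with positive diagonal entries such that $DC$ is symmetric. A quasi-Cartan matrix is a symmetrizable matrix all of whose main diagonal entries equal $2$. A quasi-Cartan companion of a skew-symmetrizable matrix $B$ is a quasi-Cartan matrix $C$ with $|c_{ij}|=|b_{ij}|$ for all $i\neq j$. A symmetrizable matrix $C$ is positive if its symmetrized matrix $DC$ is positive definite (equivalently, all leading principal submatrices of $C$ have positive determinant). *)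

(* Defs.v *)
From mathcomp Require Import all_boot all_order all_algebra.
From mathcomp Require Import reals.

Set Implicit Arguments.
Unset Strict Implicit.
Unset Printing Implicit Defensive.

Import Order.TTheory GRing.Theory Num.Theory.

Local Open Scope ring_scope.

(* A tape, infinite in both directions: the cell under the head and the cells
   on either side of it, nearest first; every cell not listed is blank. *)
Record tape (S : Type) := Tape { tleft : seq S; tcur : S; tright : seq S }.

Inductive direction := GoLeft | GoRight | Stay.

Definition twrite (S : Type) (s : S) (t : tape S) : tape S :=
  Tape (tleft t) s (tright t).

Definition tmove (S : Type) (blank : S) (d : direction) (t : tape S) : tape S :=
  match d with
  | GoLeft =>
      Tape (behead (tleft t)) (head blank (tleft t)) (tcur t :: tright t)
  | GoRight =>
      Tape (tcur t :: tleft t) (head blank (tright t)) (behead (tright t))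
  | Stay => t
  end.

Definition tape_of (S : Type) (blank : S) (w : seq S) : tape S :=
  Tape [::] (head blank w) (behead w).

(* [None] is the blank, [Some (inl b)] an input bit, [Some (inr g)] an
   auxiliary symbol. *)
Definition symbol (G : Type) := option (bool + G)%type.

(* Deterministic multitape Turing machines. [tm_halt q = None] if the machine
   keeps running in state [q], and [Some b] if it halts there, accepting iff
   [b = true]. *)
Record tm := TM {
  tm_ntapes : nat;
  tm_aux : finType;
  tm_state : finType;
  tm_start : tm_state;
  tm_halt : tm_state -> option bool;
  tm_trans : tm_state -> {ffun 'I_tm_ntapes -> symbol tm_aux} ->
             tm_state * ('I_tm_ntapes -> symbol tm_aux * direction)
}.

Definition tm_config (M : tm) : Type :=
  (tm_state M * ('I_(tm_ntapes M) -> tape (symbol (tm_aux M))))%type.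

Definition tm_step (M : tm) (c : tm_config M) : tm_config M :=
  if tm_halt c.1 is Some _ then c else
  let a := tm_trans c.1 [ffun i => tcur (c.2 i)] in
  (a.1, fun i => tmove None (a.2 i).2 (twrite (a.2 i).1 (c.2 i))).

(* The i-th word of [ws] is written on the i-th tape, with the head on its
   first letter; the remaining tapes are blank. *)
Definition tm_init (M : tm) (ws : seq (seq bool)) : tm_config M :=
  (tm_start M,
   fun i : 'I_(tm_ntapes M) =>
     tape_of None [seq Some (inl b) | b <- nth [::] ws i]).

(* [Some b] if [M], started on [ws], has halted with verdict [b] after at most
   [t] steps, and [None] if it is still running. *)
Definition tm_run (M : tm) (ws : seq (seq bool)) (t : nat) : option bool :=
  tm_halt (iter t (@tm_step M) (tm_init M ws)).1.

Definition polytime_rel (V : rel (seq bool)) : Prop :=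
  exists (M : tm) (p : {poly nat}),
    forall x y : seq bool,
      tm_run M [:: x; y] p.[(size x + size y)%N] = Some (V x y).

Definition in_NP (L : seq bool -> Prop) : Prop :=
  exists (V : rel (seq bool)) (q : {poly nat}),
    polytime_rel V /\
    forall x : seq bool,
      L x <-> exists y : seq bool, (size y <= q.[size x])%N /\ V x y.

(* Binary expansion, least significant bit first; the last bit is 1, and 0 is
   the empty word. *)
Definition bits (m : nat) : seq bool :=
  mkseq (fun i => odd (m %/ 2 ^ i)) (up_log 2 m.+1).

(* Self-delimiting: each binary digit is preceded by a 1, and a 0 marks the
   end. *)
Definition encode_nat (m : nat) : seq bool :=
  flatten [seq [:: true; b] | b <- bits m] ++ [:: false].

Definition encode_int (z : int) : seq bool :=
  (z < 0) :: encode_nat `|z|%N.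

Definition encode_mx (n : nat) (B : 'M[int]_n) : seq bool :=
  encode_nat n ++
  flatten [seq encode_int (B i j) | i <- enum 'I_n, j <- enum 'I_n].

Definition pos_diag_mx (n : nat) (D : 'M[rat]_n) : Prop :=
  is_diag_mx D /\ forall i, 0 < D i i.

Definition ratmx (n : nat) (A : 'M[int]_n) : 'M[rat]_n := map_mx intr A.

Definition skew_symmetrizable (n : nat) (B : 'M[int]_n) : Prop :=
  exists D : 'M[rat]_n, pos_diag_mx D /\ D *m ratmx B \is skewmx.

Definition symmetrizer (n : nat) (C : 'M[int]_n) (D : 'M[rat]_n) : Prop :=
  pos_diag_mx D /\ D *m ratmx C \is symmetricmx.

Definition symmetrizable (n : nat) (C : 'M[int]_n) : Prop :=
  exists D : 'M[rat]_n, symmetrizer C D.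

Definition quasi_cartan (n : nat) (C : 'M[int]_n) : Prop :=
  symmetrizable C /\ forall i, C i i = 2.

Definition quasi_cartan_companion (n : nat) (B C : 'M[int]_n) : Prop :=
  quasi_cartan C /\ forall i j, i != j -> `|C i j| = `|B i j|.

Definition posdefmx (R : realFieldType) (n : nat) (A : 'M[R]_n) : Prop :=
  forall v : 'cV[R]_n, v != 0 -> 0 < (v^T *m A *m v) 0 0.

(* Positive definiteness is tested on real vectors. Whether it holds does not
   depend on the symmetrizer [D]. *)
Definition positive_mx (R : realType) (n : nat) (C : 'M[int]_n) : Prop :=
  exists D : 'M[rat]_n,
    symmetrizer C D /\ posdefmx (map_mx (ratr : rat -> R) (D *m ratmx C)).

Definition has_positive_companion (R : realType) (n : nat) (B : 'M[int]_n) :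
    Prop :=
  exists C : 'M[int]_n, quasi_cartan_companion B C /\ positive_mx R C.

(* The set of encodings of yes-instances; in particular, words that do not
   encode an instance are not in it. *)
Definition positive_companion_problem (R : realType) (x : seq bool) : Prop :=
  exists (n : nat) (B : 'M[int]_n),
    [/\ (0 < n)%N, skew_symmetrizable B, has_positive_companion R B
      & x = encode_mx B].

(* Main.v *)
Require Import Defs.
From mathcomp Require Import all_boot all_order all_algebra.
From mathcomp Require Import perm reals boolp zify ring.

(** If C is a positive quasi-Cartan companion of B, then c_ij c_ji < 4 for i <> j,
    so all entries of B are at most 3 in absolute value, and B can be
    skew-symmetrized by numbers d_i = 2^a_i 3^b_i with a_i, b_i <= 2n, obtained by
    following a simple path in each connected component. By Gaussian elimination,
    C is positive iff some lower triangular integer matrix L with positive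
    diagonal makes L C upper triangular with positive diagonal: then
    L D^-1 (D C) D^-1 L^T is diagonal with positive entries, where D is the
    diagonal matrix of the d_i. Conversely the rows of L are, up to sign, the last
    rows of the adjugates of the leading principal submatrices of C, so the entries
    of L have polynomially many bits. A certificate lists the entries of B, the
    signs of C, the bits of L and the exponents a_i, b_i in unary. The entries of
    L C are sums of large integers with small coefficients, and only their signs
    matter, so a clamped Horner evaluation suffices, and the verifier needs
    nothing but polynomially bounded counters.

    A counter is the position of a head on a tape of a Turing machine whose
    tapes carry a marker to the left of the input. Polynomial-time computable
    functions of such counters are closed under composition, branching and
    iterations whose intermediate values are polynomially bounded. *)

Set Implicit Arguments.
Unset Strict Implicit.
Unset Printing Implicit Defensive.

Import Order.TTheory GRing.Theory Num.Theory.

(** * Counter programs and Turing machines *)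

Definition sym : Type := symbol unit.

Definition mark : sym := Some (inr tt).

(* Cell 0 is the marker and the word [w] is written from cell 1 on. *)
Definition cell (w : seq bool) (v : nat) : sym :=
  if v is v'.+1 then nth None [seq Some (inl b) | b <- w] v' else mark.

Lemma cell_mark w v : (cell w v == mark) = (v == 0).
Proof.
case: v => [|v] //=; apply/eqP.
case: (ltnP v (size w)) => [lt|ge].
  by rewrite (nth_map false).
by rewrite nth_default // size_map.
Qed.

(* A register is the position of the head of the tape with the same number;
   tapes 0 and 1 contain the two input words. *)
Inductive cmd :=
| Inc of nat
| Dec of nat
| Seq of cmd & cmd
| If of nat & sym & cmd & cmd
| While of nat & sym & cmd.

Definition regs := nat -> nat.

Definition upd (s : regs) (r v : nat) : regs :=
  fun r' => if r' == r then v else s r'.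

Definition word_of (x y : seq bool) (r : nat) : seq bool := nth [::] [:: x; y] r.

(* [While r a c] iterates [c] until the head of tape [r] reads [a]. *)
Inductive exec (x y : seq bool) : cmd -> regs -> regs -> nat -> Prop :=
| exec_inc r s : exec x y (Inc r) s (upd s r (s r).+1) 1
| exec_dec r s : 0 < s r -> exec x y (Dec r) s (upd s r (s r).-1) 1
| exec_seq c1 c2 s1 s2 s3 t1 t2 :
    exec x y c1 s1 s2 t1 -> exec x y c2 s2 s3 t2 ->
    exec x y (Seq c1 c2) s1 s3 (t1 + t2)
| exec_then r a c1 c2 s s' t :
    cell (word_of x y r) (s r) == a -> exec x y c1 s s' t ->
    exec x y (If r a c1 c2) s s' t.+1
| exec_else r a c1 c2 s s' t :
    cell (word_of x y r) (s r) != a -> exec x y c2 s s' t ->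
    exec x y (If r a c1 c2) s s' t.+1
| exec_done r a c s :
    cell (word_of x y r) (s r) == a -> exec x y (While r a c) s s 1
| exec_loop r a c s1 s2 s3 t1 t2 :
    cell (word_of x y r) (s1 r) != a -> exec x y c s1 s2 t1 ->
    exec x y (While r a c) s2 s3 t2 ->
    exec x y (While r a c) s1 s3 (t1 + t2).+1.

(** * Compilation of commands into a finite control *)

Fixpoint control (c : cmd) : finType :=
  match c with
  | Inc _ | Dec _ => unit
  | Seq c1 c2 => (control c1 + control c2)%type
  | If _ _ c1 c2 => option (control c1 + control c2)%type
  | While _ _ c => option (control c)
  end.

Fixpoint cstart (c : cmd) : control c :=
  match c with
  | Inc _ | Dec _ => tt
  | Seq c1 c2 => inl (cstart c1)
  | If _ _ _ _ | While _ _ _ => None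
  end.

Definition move_only (r : nat) (d : direction) : nat -> direction :=
  fun r' => if r' == r then d else Stay.

(* The next control state is [None] when the command terminates. *)
Fixpoint cnext (c : cmd) :
    control c -> (nat -> sym) -> option (control c) * (nat -> direction) :=
  match c with
  | Inc r => fun _ _ => (None, move_only r GoRight)
  | Dec r => fun _ _ => (None, move_only r GoLeft)
  | Seq c1 c2 => fun q a =>
      match q with
      | inl q1 => let n := cnext q1 a in
                  (Some (if n.1 is Some q' then inl q' else inr (cstart c2)), n.2)
      | inr q2 => let n := cnext q2 a in (omap inr n.1, n.2)
      end
  | If r b c1 c2 => fun q a =>
      match q with
      | None => (Some (Some (if a r == b then inl (cstart c1)
                             else inr (cstart c2))), fun=> Stay)
      | Some (inl q1) => let n := cnext q1 a in (omap (Some \o inl) n.1, n.2)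
      | Some (inr q2) => let n := cnext q2 a in (omap (Some \o inr) n.1, n.2)
      end
  | While r b c => fun q a =>
      match q with
      | None => (if a r == b then None else Some (Some (cstart c)), fun=> Stay)
      | Some q1 => let n := cnext q1 a in (Some n.1, n.2)
      end
  end.

Definition moves (s : regs) (d : nat -> direction) : regs := fun r =>
  match d r with GoRight => (s r).+1 | GoLeft => (s r).-1 | Stay => s r end.

Definition legal (s : regs) (d : nat -> direction) :=
  forall r, d r = GoLeft -> 0 < s r.

Definition reads (x y : seq bool) (s : regs) : nat -> sym :=
  fun r => cell (word_of x y r) (s r).

(** Small-step counterpart of [exec], with the exact number of control steps; the last one is the
    step that exits. *)
Inductive runs (x y : seq bool) (c : cmd) : control c -> regs -> regs -> nat -> Prop :=
| runs_exit q s d :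
    cnext q (reads x y s) = (None, d) -> legal s d -> runs x y q s (moves s d) 1
| runs_next q q' s s' d t :
    cnext q (reads x y s) = (Some q', d) -> legal s d ->
    runs x y q' (moves s d) s' t -> runs x y q s s' t.+1.

Section Runs.
Variables x y : seq bool.

Lemma moves_only_right s r : moves s (move_only r GoRight) = upd s r (s r).+1.
Proof. by apply/funext => r'; rewrite /moves /move_only /upd; case: eqP => [->|]. Qed.

Lemma moves_only_left s r : moves s (move_only r GoLeft) = upd s r (s r).-1.
Proof. by apply/funext => r'; rewrite /moves /move_only /upd; case: eqP => [->|]. Qed.

Lemma runs_seq_right c1 c2 (q : control c2) s s' t :
  runs x y q s s' t -> @runs x y (Seq c1 c2) (inr q) s s' t.
Proof.
elim=> [{}q {}s d E L|{}q q' {}s {}s' d {}t E L _ IH].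
  by apply: runs_exit => //=; rewrite E.
by apply: runs_next IH => //=; rewrite E.
Qed.

(** The step that leaves [c1] is itself the transition into the start of [c2], so the durations add
    up exactly. *)
Lemma runs_seq_left c1 c2 (q : control c1) s1 s2 s3 t1 t2 :
  runs x y q s1 s2 t1 -> runs x y (cstart c2) s2 s3 t2 ->
  @runs x y (Seq c1 c2) (inl q) s1 s3 (t1 + t2).
Proof.
move=> H1 H2; elim: H1 H2 => [{}q s d E L|{}q q' s s' d t E L _ IH] H2.
  by rewrite add1n; apply: runs_next (runs_seq_right _ H2); rewrite //= E.
by rewrite addSn; apply: runs_next (IH H2); rewrite //= E.
Qed.

Lemma runs_then r a c1 c2 (q : control c1) s s' t :
  runs x y q s s' t -> @runs x y (If r a c1 c2) (Some (inl q)) s s' t.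
Proof.
elim=> [{}q {}s d E L|{}q q' {}s {}s' d {}t E L _ IH].
  by apply: runs_exit => //=; rewrite E.
by apply: runs_next IH => //=; rewrite E.
Qed.

Lemma runs_else r a c1 c2 (q : control c2) s s' t :
  runs x y q s s' t -> @runs x y (If r a c1 c2) (Some (inr q)) s s' t.
Proof.
elim=> [{}q {}s d E L|{}q q' {}s {}s' d {}t E L _ IH].
  by apply: runs_exit => //=; rewrite E.
by apply: runs_next IH => //=; rewrite E.
Qed.

Lemma runs_loop r a c (q : control c) s1 s2 s3 t1 t2 :
  runs x y q s1 s2 t1 -> @runs x y (While r a c) None s2 s3 t2 ->
  @runs x y (While r a c) (Some q) s1 s3 (t1 + t2).
Proof.
move=> H1 H2; elim: H1 H2 => [{}q s d E L|{}q q' s s' d t E L _ IH] H2.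
  by rewrite add1n; apply: runs_next H2; rewrite //= E.
by rewrite addSn; apply: runs_next (IH H2); rewrite //= E.
Qed.

(** A test of [If] or [While] takes one step from the control state [None], which is the extra
    successor in the durations of [exec]. *)
Lemma exec_runs c s s' t : exec x y c s s' t -> runs x y (cstart c) s s' t.
Proof.
elim=> {c s s' t}.
- move=> r s; rewrite -moves_only_right; apply: runs_exit => // r'.
  by rewrite /move_only; case: eqP.
- move=> r s s0; rewrite -moves_only_left; apply: runs_exit => // r'.
  by rewrite /move_only; case: eqP => [->|].
- by move=> c1 c2 s1 s2 s3 t1 t2 _ H1 _ H2; apply: runs_seq_left H1 H2.
- move=> r a c1 c2 s s' t E _ H.
  apply: (runs_next (d := fun=> Stay)) (runs_then r a c2 H) => //=.
  by rewrite /reads E.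
- move=> r a c1 c2 s s' t E _ H.
  apply: (runs_next (d := fun=> Stay)) (runs_else r a c1 H) => //=.
  by rewrite /reads (negPf E).
- move=> r a c s E; rewrite -[X in runs _ _ _ _ X](erefl : moves s (fun=> Stay) = s).
  by apply: runs_exit => //=; rewrite /reads E.
- move=> r a c s1 s2 s3 t1 t2 E _ H1 _ H2.
  by apply: (runs_next (d := fun=> Stay)) (runs_loop H1 H2) => //=; rewrite /reads (negPf E).
Qed.

End Runs.

(** * Simulation of the control by a Turing machine *)

Fixpoint nregs (c : cmd) : nat :=
  match c with
  | Inc r | Dec r => r.+1
  | Seq c1 c2 => maxn (nregs c1) (nregs c2)
  | If r _ c1 c2 => maxn r.+1 (maxn (nregs c1) (nregs c2))
  | While r _ c => maxn r.+1 (nregs c)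
  end.

(** This permits a machine with finitely many tapes: the control inspects only registers named in
    the command. *)
Lemma cnext_ext c (q : control c) k a a' :
  nregs c <= k -> (forall r, r < k -> a r = a' r) -> cnext q a = cnext q a'.
Proof.
move=> + E; elim: c q => //=.
- move=> c1 IH1 c2 IH2 q; rewrite geq_max => /andP[/IH1 H1 /IH2 H2].
  by case: q => q; rewrite ?H1 ?H2.
- move=> r b c1 IH1 c2 IH2 q; rewrite !geq_max => /and3P[lt /IH1 H1 /IH2 H2].
  by case: q => [[]|] *; rewrite ?H1 ?H2 ?E.
- move=> r b c IH q; rewrite !geq_max => /andP[lt /IH H].
  by case: q => *; rewrite ?H ?E.
Qed.

Definition tape_at (u : seq sym) (v : nat) : tape sym :=
  Tape (rev (take v u)) (nth None u v) (drop v.+1 u).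

Lemma tape_at_right u v : v.+1 < size u ->
  tmove None GoRight (tape_at u v) = tape_at u v.+1.
Proof.
move=> lt; rewrite /tape_at /=.
by rewrite (take_nth None (ltnW lt)) rev_rcons (drop_nth None lt).
Qed.

Lemma tape_at_extend u v : v.+1 = size u ->
  tmove None GoRight (tape_at u v) = tape_at (rcons u None) v.+1.
Proof.
move=> E; have lt : v < size u by rewrite -E.
rewrite /tape_at /= E !drop_oversize ?size_rcons //=.
rewrite nth_rcons ltnn eqxx -cats1 take_size_cat // -rev_rcons -take_nth //.
by rewrite E take_size.
Qed.

Lemma tape_at_left u v : v.+1 < size u ->
  tmove None GoLeft (tape_at u v.+1) = tape_at u v.
Proof.
move=> lt; rewrite /tape_at /= (take_nth None (ltnW lt)) rev_rcons /=.
by rewrite -drop_nth.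
Qed.

(** Cells become listed as the head passes over them, so a tape is known only up to a number of
    explicit trailing blanks. *)
Definition padded (w : seq bool) (m : nat) : seq sym :=
  mark :: [seq Some (inl b) | b <- w] ++ nseq m None.

Definition tape_holds (w : seq bool) (v : nat) (t : tape sym) :=
  exists m, v < size (padded w m) /\ t = tape_at (padded w m) v.

Lemma tape_holds_cur w v t : tape_holds w v t -> tcur t = cell w v.
Proof.
case=> m [lt ->] /=; case: v lt => //= v _.
by rewrite nth_cat nth_nseq if_same; case: ltnP => // ge; rewrite nth_default.
Qed.

Lemma tape_holds_right w v t :
  tape_holds w v t -> tape_holds w v.+1 (tmove None GoRight t).
Proof.
case=> m [lt ->]; case: (ltnP v.+1 (size (padded w m))) => [lt'|ge].
  by exists m; rewrite tape_at_right.
have E : v.+1 = size (padded w m) by apply/eqP; rewrite eqn_leq lt ge.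
have padS : padded w m.+1 = rcons (padded w m) None.
  by rewrite /padded -addn1 nseqD catA cats1.
by exists m.+1; rewrite tape_at_extend // padS size_rcons E.
Qed.

Lemma tape_holds_left w v t :
  0 < v -> tape_holds w v t -> tape_holds w v.-1 (tmove None GoLeft t).
Proof.
case: v => // v _ [m [lt ->]]; exists m.
by rewrite tape_at_left //; split => //; apply: ltnW.
Qed.

Section Machine.
Variables (c : cmd) (out : nat).

Definition machine_ntapes := maxn 2 (maxn out.+1 (nregs c)).

(** The states [inl (inl _)] step left of the input and print the marker, [inl (inr _)] runs the
    command, with [None] for the final test of register [out], and [inr b] has halted. *)
Definition machine_state : finType :=
  ((bool + option (control c)) + bool)%type.

Definition reads_ord (a : {ffun 'I_machine_ntapes -> sym}) (r : nat) : sym :=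
  if insub r is Some i then a i else None.

Definition machine_trans (q : machine_state) (a : {ffun 'I_machine_ntapes -> sym}) :
    machine_state * ('I_machine_ntapes -> sym * direction) :=
  match q with
  | inl (inl false) => (inl (inl true), fun i => (a i, GoLeft))
  | inl (inl true) => (inl (inr (Some (cstart c))), fun=> (mark, Stay))
  | inl (inr (Some q)) =>
      let n := cnext q (reads_ord a) in (inl (inr n.1), fun i => (a i, n.2 i))
  | inl (inr None) => (inr (reads_ord a out != mark), fun i => (a i, Stay))
  | inr b => (inr b, fun i => (a i, Stay))
  end.

Definition machine : tm :=
  @TM machine_ntapes unit machine_state (inl (inl false))
    (fun q => if q is inr b then Some b else None) machine_trans.

Variables x y : seq bool.

Definition holds (s : regs) (f : 'I_machine_ntapes -> tape sym) :=
  forall i : 'I_machine_ntapes, tape_holds (word_of x y i) (s i) (f i).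

Lemma reads_ordE s f r : holds s f -> r < machine_ntapes ->
  reads_ord [ffun i : 'I_machine_ntapes => tcur (f i)] r = reads x y s r.
Proof.
move=> H lt; rewrite /reads_ord insubT ffunE /=.
exact: tape_holds_cur (H (Ordinal lt)).
Qed.

Lemma twrite_cur (t : tape sym) : twrite (tcur t) t = t.
Proof. by case: t. Qed.

Lemma holds_moves s d f : holds s f -> legal s d ->
  holds (moves s d) (fun i : 'I_machine_ntapes =>
    tmove None (d i) (twrite (tcur (f i)) (f i))).
Proof.
move=> H L i; rewrite twrite_cur /moves; case E: (d i) => //.
- by apply: tape_holds_left => //; apply: L.
- exact: tape_holds_right.
Qed.

Lemma machine_runs (q : control c) s s' t f : runs x y q s s' t -> holds s f ->
  exists f', holds s' f' /\
  iter t (@tm_step machine) (inl (inr (Some q)), f) = (inl (inr None), f').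
Proof.
have step (q0 : control c) s0 f0 : holds s0 f0 ->
    @tm_step machine (inl (inr (Some q0)), f0) =
    let n := cnext q0 (reads x y s0) in
    (inl (inr n.1),
     fun i : 'I_machine_ntapes => tmove None (n.2 i) (twrite (tcur (f0 i)) (f0 i))).
  move=> H; rewrite /tm_step /=.
  have -> : cnext q0 (reads_ord [ffun i : 'I_machine_ntapes => tcur (f0 i)]) =
      cnext q0 (reads x y s0).
    apply: (@cnext_ext _ _ machine_ntapes); first by rewrite !leq_max leqnn !orbT.
    by move=> r; apply: reads_ordE.
  by congr pair; apply/funext => i; rewrite ffunE.
move=> R; elim: R f => [{}q {}s d E L|{}q q' {}s {}s' d {}t E L _ IH] f H.
  exists (fun i : 'I_machine_ntapes => tmove None (d i) (twrite (tcur (f i)) (f i))); split.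
    exact: holds_moves.
  by rewrite /= (step _ _ _ H) E.
have [f' [H' E']] := IH _ (holds_moves H L).
by exists f'; split => //; rewrite iterSr (step _ _ _ H) E.
Qed.

(** Two of the three extra steps install the markers and one gives the verdict. A halted
    configuration is a fixed point, so any larger time serves as well. *)
Lemma machine_decides s t p : exec x y c (fun=> 0) s t -> t + 3 <= p ->
  tm_run machine [:: x; y] p = Some (0 < s out).
Proof.
move=> /exec_runs R le; rewrite /tm_run.
pose f (i : 'I_machine_ntapes) := Tape [::] mark
  (let t := tape_of None [seq Some (inl b) | b <- word_of x y i] in
   tcur t :: tright t).
have H : holds (fun=> 0) f.
  (* For the empty word one blank is already listed, because the head started on it. *)
  move=> i; rewrite /f; case: (word_of x y i) => [|b w]; first by exists 1.
  by exists 0; rewrite /padded /tape_at /= cats0.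
have E2 : iter 2 (@tm_step machine) (tm_init machine [:: x; y]) =
    (inl (inr (Some (cstart c))), f).
  rewrite /= {2}/tm_step /= /tm_step /=; congr pair; apply/funext => i.
  by rewrite ffunE.
have [f' [H' E']] := machine_runs R H.
have {le} -> : p = p - (t + 3) + (1 + (t + 2)) by lia.
rewrite 3!iterD E2 E' /=.
have -> n : iter n (@tm_step machine) (@tm_step machine (inl (inr None), f')) =
    @tm_step machine (inl (inr None), f') by elim: n => //= n ->.
rewrite /tm_step /= (reads_ordE H') ?cell_mark -?lt0n //.
by rewrite !leq_max leqnn orbT.
Qed.

End Machine.

Lemma polytime_exec (V : rel (seq bool)) (c : cmd) (out : nat) (p : {poly nat}) :
  (forall x y, exists s t,
     [/\ exec x y c (fun=> 0) s t, t <= p.[(size x + size y)%N]%R &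
         (0 < s out) = V x y]) -> polytime_rel V.
Proof.
move=> H; exists (machine c out), (p + 3%:P)%R => x y.
have [s [t [E le <-]]] := H x y.
apply: machine_decides E _; rewrite hornerD hornerC.
by rewrite leq_add2r.
Qed.

(** Each step raises a head position by at most one; hence running times bound computed values. *)
Lemma exec_grow x y c s s' t r : exec x y c s s' t -> s' r <= s r + t.
Proof.
elim=> {c s s' t}; rewrite /upd.
- by move=> r' s; case: eqP => [->|_]; lia.
- by move=> r' s; case: eqP => [->|_]; lia.
all: by move=> *; lia.
Qed.

(** * Commands with time bounds *)

Definition skip : cmd := Seq (Inc 2) (Dec 2).

Section Execution.
Variables x y : seq bool.

Definition exec_within (c : cmd) (s s' : regs) (b : nat) :=
  exists2 t, exec x y c s s' t & t <= b.

Lemma within_le c s s' b b' : b <= b' -> exec_within c s s' b -> exec_within c s s' b'.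
Proof. by move=> le [t E le']; exists t => //; apply: leq_trans le. Qed.

Lemma within_eq c s s' s'' b b' : s' = s'' -> b <= b' ->
  exec_within c s s' b -> exec_within c s s'' b'.
Proof. by move=> <-; apply: within_le. Qed.

Lemma within_inc r s : exec_within (Inc r) s (upd s r (s r).+1) 1.
Proof. by exists 1 => //; apply: exec_inc. Qed.

Lemma within_dec r s : 0 < s r -> exec_within (Dec r) s (upd s r (s r).-1) 1.
Proof. by exists 1 => //; apply: exec_dec. Qed.

Lemma within_seq c1 c2 s1 s2 s3 b1 b2 :
  exec_within c1 s1 s2 b1 -> exec_within c2 s2 s3 b2 ->
  exec_within (Seq c1 c2) s1 s3 (b1 + b2).
Proof.
move=> [t1 E1 le1] [t2 E2 le2]; exists (t1 + t2); first exact: exec_seq E1 E2.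
exact: leq_add.
Qed.

Lemma within_skip s : exec_within skip s s 2.
Proof.
apply: within_eq (within_seq (within_inc 2 s) (within_dec _)) => //.
by apply/funext => r; rewrite /upd eqxx; case: eqP => [->|].
Qed.

Lemma within_if r a c1 c2 s s' b :
  (cell (word_of x y r) (s r) == a -> exec_within c1 s s' b) ->
  (cell (word_of x y r) (s r) != a -> exec_within c2 s s' b) ->
  exec_within (If r a c1 c2) s s' b.+1.
Proof.
move=> H1 H2; case: (boolP (cell (word_of x y r) (s r) == a)) => E.
  by have [t X le] := H1 E; exists t.+1 => //; apply: exec_then.
by have [t X le] := H2 E; exists t.+1 => //; apply: exec_else.
Qed.

Lemma within_while r a c (st : nat -> regs) n b :
  (forall i, i < n -> cell (word_of x y r) (st i r) != a) ->
  cell (word_of x y r) (st n r) == a ->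
  (forall i, i < n -> exec_within c (st i) (st i.+1) b) ->
  exec_within (While r a c) (st 0) (st n) (n * b.+1).+1.
Proof.
elim: n st => [|n IH] st neq eqn H.
  by exists 1 => //; apply: exec_done.
have [i lt||i lt|t E le] := IH (st \o succn).
- exact: (neq i.+1).
- exact: eqn.
- exact: (H i.+1).
have [t' E' le'] := H 0 isT.
exists (t' + t).+1; last by rewrite mulSn; lia.
by apply: exec_loop E' E; apply: neq.
Qed.

Lemma within_for r c (st : nat -> regs) n b :
  (forall i, i <= n -> st i r = n - i) ->
  (forall i, i < n -> exec_within c (st i) (st i.+1) b) ->
  exec_within (While r mark c) (st 0) (st n) (n * b.+1).+1.
Proof.
move=> E; apply: within_while => [i lt|].
  by rewrite cell_mark E 1?ltnW // subn_eq0 -ltnNge.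
by rewrite cell_mark E // subnn.
Qed.

End Execution.


Ltac regs_eq :=
  let r := fresh "r" in apply/funext => r; rewrite /upd /=;
  repeat (case: eqP => ?);
  first [done | exfalso; congruence | lia
        | match goal with E : r = _ |- _ => rewrite E; (done || lia) end].

Section Moves.
Variables x y : seq bool.

Definition move_reg r d : cmd := While r mark (Seq (Dec r) (Inc d)).

Lemma within_move r d s : r != d ->
  exec_within x y (move_reg r d) s (upd (upd s r 0) d (s d + s r)) (3 * s r).+1.
Proof.
move=> /eqP neq; pose st i := upd (upd s r (s r - i)) d (s d + i).
have st0 : st 0 = s by rewrite /st; regs_eq.
have -> : upd (upd s r 0) d (s d + s r) = st (s r) by rewrite /st; regs_eq.
rewrite -{1}st0 mulnC; apply: within_for => i lt.
  by rewrite /st /upd eqxx; case: eqP.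
apply: within_eq (within_seq (within_dec _ _ _) (within_inc _ _ _ _)) => //.
  by rewrite /st; regs_eq.
by rewrite /st /upd eqxx; case: eqP => //; lia.
Qed.

Definition clear r : cmd := While r mark (Dec r).

Lemma within_clear r s : exec_within x y (clear r) s (upd s r 0) (2 * s r).+1.
Proof.
pose st i := upd s r (s r - i).
have st0 : st 0 = s by rewrite /st; regs_eq.
have -> : upd s r 0 = st (s r) by rewrite /st; regs_eq.
rewrite -{1}st0 mulnC; apply: within_for => i lt; first by rewrite /st /upd eqxx.
apply: within_eq (within_dec _ _ _) => //; rewrite /st ?/upd ?eqxx; last by lia.
by regs_eq.
Qed.

(* [z] is a scratch register, equal to 0 before and after. *)
Definition copy_reg r d z : cmd :=
  Seq (While r mark (Seq (Seq (Dec r) (Inc d)) (Inc z))) (move_reg z r).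

Lemma within_copy r d z s : r != d -> d != z -> r != z -> s z = 0 ->
  exec_within x y (copy_reg r d z) s (upd s d (s d + s r)) (7 * s r + 2).
Proof.
move=> /eqP rd /eqP dz /eqP rz sz.
pose st i := upd (upd (upd s r (s r - i)) d (s d + i)) z i.
have st0 : st 0 = s by rewrite /st; regs_eq.
have H : exec_within x y (While r mark (Seq (Seq (Dec r) (Inc d)) (Inc z))) s
    (st (s r)) (s r * 4).+1.
  rewrite -{1}st0; apply: within_for => i lt.
    by rewrite /st /upd eqxx; case: eqP => // _; case: eqP.
  apply: within_eq (within_seq (within_seq (within_dec _ _ _)
    (within_inc _ _ _ _)) (within_inc _ _ _ _)) => //.
    by rewrite /st; regs_eq.
  by rewrite /st /upd eqxx; case: eqP => // _; case: eqP => //; lia.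
have zr : z != r by apply/eqP => E; apply: rz.
apply: within_eq (within_seq H (within_move (st (s r)) zr)).
  by rewrite /st; regs_eq.
suff -> : st (s r) z = s r by lia.
by rewrite /st /upd eqxx.
Qed.

End Moves.

(** * Contexts and polynomial bounds *)

Fixpoint ctx (k : nat) : Type := if k is k'.+1 then (ctx k' * nat)%type else unit.

(** The most recently bound variable is the last component of a context and comes first here, so
    index 0 is the innermost binder. *)
Fixpoint vals k : ctx k -> seq nat :=
  if k is k'.+1 then fun e => e.2 :: vals e.1 else fun=> [::].

Lemma size_vals k (e : ctx k) : size (vals e) = k.
Proof. by elim: k e => //= k IH [e v]; rewrite IH. Qed.

(* Any bound of the form [poly_base ^ a] with a constant exponent [a] is
   polynomial, and the base [>= 2] makes this class closed under sums. *)
Definition poly_base (x y : seq bool) k (e : ctx k) : nat :=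
  size x + size y + sumn (vals e) + 2.

Definition poly_bounded k (f : seq bool -> seq bool -> ctx k -> nat) :=
  exists a, forall x y e, f x y e <= poly_base x y e ^ a.

Lemma leq_expl m n a : m <= n -> m ^ a <= n ^ a.
Proof. by case: a => // a; rewrite leq_exp2r. Qed.

Section PolyBounded.
Variable k : nat.
Implicit Types f g : seq bool -> seq bool -> ctx k -> nat.

Lemma poly_bounded_le f g :
  (forall x y e, f x y e <= g x y e) -> poly_bounded g -> poly_bounded f.
Proof. by move=> le [a H]; exists a => x y e; apply: leq_trans (H x y e). Qed.

Lemma poly_bounded_base : poly_bounded (fun x y (e : ctx k) => poly_base x y e).
Proof. by exists 1. Qed.

Lemma poly_bounded_const c : poly_bounded (fun x y (e : ctx k) => c).
Proof.
exists c => x y e; apply: leq_trans (ltnW (ltn_expl c (isT : 1 < 2))) _.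
by apply: leq_expl; rewrite leq_addl.
Qed.

Lemma poly_bounded_mul f g : poly_bounded f -> poly_bounded g ->
  poly_bounded (fun x y e => f x y e * g x y e).
Proof.
by move=> [a H] [b H']; exists (a + b) => x y e; rewrite expnD leq_mul.
Qed.

(** With base [N >= 2] and [m] the larger exponent, the sum is at most [2 * N ^ m], hence at most
    [N ^ m.+1]. *)
Lemma poly_bounded_add f g : poly_bounded f -> poly_bounded g ->
  poly_bounded (fun x y e => f x y e + g x y e).
Proof.
move=> [a H] [b H']; exists (maxn a b).+1 => x y e.
have N0 : 1 < poly_base x y e by rewrite /poly_base addn2.
rewrite expnS; apply: leq_trans (leq_mul N0 (leqnn _)).
rewrite mul2n -addnn; apply: leq_add.
  by apply: leq_trans (H _ _ _) _; rewrite leq_exp2l // leq_maxl.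
by apply: leq_trans (H' _ _ _) _; rewrite leq_exp2l // leq_maxr.
Qed.

Lemma poly_bounded_exp f a : poly_bounded f ->
  poly_bounded (fun x y e => f x y e ^ a).
Proof. by move=> [b H]; exists (b * a) => x y e; rewrite expnM leq_expl. Qed.

End PolyBounded.

(** * Polynomial-time functions of counters *)

Ltac poly_bound :=
  repeat match goal with
  | |- poly_bounded (fun x y e => _ + _) => apply: poly_bounded_add
  | |- poly_bounded (fun x y e => _ * _) => apply: poly_bounded_mul
  | |- poly_bounded (fun x y e => _ ^ _) => apply: poly_bounded_exp
  | |- poly_bounded (fun x y e => poly_base x y e) => exact: poly_bounded_base
  | |- poly_bounded (fun x y e => _) => first [exact: poly_bounded_const | assumption]
  | |- poly_bounded _ => assumption
  end.

(* [c rs m] computes [f] of the registers [rs] into the register [m], leaving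
   all registers below [m] unchanged and using those above [m] as scratch. *)
Definition polytime k (f : seq bool -> seq bool -> ctx k -> nat) :=
  exists (c : seq nat -> nat -> cmd) b, poly_bounded b /\
  forall x y (e : ctx k) rs m s,
    1 < m -> all (fun r => r < m) rs -> [seq s r | r <- rs] = vals e ->
    s 0 = 0 -> s 1 = 0 -> (forall r, m <= r -> s r = 0) ->
    exec_within x y (c rs m) s (upd s m (f x y e)) (b x y e).

Definition polytime_pred k (p : seq bool -> seq bool -> ctx k -> bool) :=
  polytime (fun x y e => nat_of_bool (p x y e)).

Lemma upd_upd s r v w : upd (upd s r v) r w = upd s r w.
Proof. by apply/funext => q; rewrite /upd; case: eqP. Qed.

Lemma upd_id s r : upd s r (s r) = s.
Proof. by apply/funext => q; rewrite /upd; case: eqP => // ->. Qed.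

Lemma upd_same s r v : upd s r v r = v.
Proof. by rewrite /upd eqxx. Qed.

Lemma upd_other s r v q : q != r -> upd s r v q = s q.
Proof. by rewrite /upd => /negPf ->. Qed.

Ltac upd_simpl := repeat first [rewrite upd_same | rewrite upd_other; [|by lia]].

Section Closure.
Variable k : nat.
Implicit Types f g : seq bool -> seq bool -> ctx k -> nat.

Lemma eq_polytime f g : (forall x y e, f x y e = g x y e) -> polytime f -> polytime g.
Proof.
move=> E [c [b [Hb H]]]; exists c, b; split => // x y e rs m s *.
by rewrite -E; apply: H.
Qed.

(** The result register starts at 0 and gains at most one per step, so the value is at most the
    running time. *)
Lemma polytime_bounded f : polytime f -> poly_bounded f.
Proof.
move=> [c [b [Hb H]]]; apply: poly_bounded_le Hb => x y e.
(* Registers 0 and 1 belong to the input words, so the arguments are placed from register 2 on. *)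
pose s r := if r < 2 then 0 else nth 0 (vals e) (r - 2).
have [||||||t E le] := H x y e (iota 2 k) (k + 2) s.
- by rewrite addn2.
- by apply/allP => r; rewrite mem_iota; lia.
- rewrite -[in iota _ _](size_vals e) -[RHS](mkseq_nth 0) /mkseq.
  rewrite (iotaDl 2 0) -map_comp; apply: eq_map => i /=.
  by rewrite /s; case: ltnP => //; rewrite ?addKn //; lia.
- by [].
- by [].
- move=> r le; rewrite /s; case: ifP => // _; rewrite nth_default // size_vals; lia.
apply: leq_trans le; have := exec_grow (k + 2) E; rewrite /upd eqxx.
by rewrite /s ltnNge addn2 /= nth_default ?size_vals // subSS subn1 /= ; lia.
Qed.

Lemma polytime_const n : polytime (fun x y (e : ctx k) => n).
Proof.
exists (fun _ m => iter n (fun c => Seq c (Inc m)) skip), (fun _ _ _ => n + 2).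
split; first exact: poly_bounded_const.
move=> x y e rs m s _ _ _ _ _ Z; elim: n => [|n IH] /=.
  apply: within_eq (within_skip x y s) => //.
  by apply/funext => r; rewrite /upd; case: eqP => // ->; rewrite Z.
apply: within_eq (within_seq IH (within_inc _ _ _ _)); last by lia.
by apply/funext => r; rewrite /upd eqxx; case: eqP.
Qed.

Lemma polytime_succ f : polytime f -> polytime (fun x y e => (f x y e).+1).
Proof.
move=> [c [b [Hb H]]]; exists (fun rs m => Seq (c rs m) (Inc m)), (fun x y e => b x y e + 1).
split; first by apply: poly_bounded_add => //; apply: poly_bounded_const.
move=> x y e rs m s m1 lt E s0 s1 Z.
apply: within_eq (within_seq (H _ _ _ _ _ _ m1 lt E s0 s1 Z) (within_inc _ _ _ _)) => //.
by apply/funext => r; rewrite /upd eqxx; case: eqP.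
Qed.

Lemma polytime_var j : polytime (fun x y (e : ctx k) => nth 0 (vals e) j).
Proof.
case: (ltnP j k) => [lt|ge]; last first.
  apply: eq_polytime (polytime_const 0) => x y e.
  by rewrite nth_default // size_vals.
exists (fun rs m => copy_reg (nth 0 rs j) m m.+1), (fun x y e => 7 * poly_base x y e + 2).
split.
  by poly_bound.
move=> x y e rs m s m1 /allP lts E s0 s1 Z.
have sz : size rs = k by rewrite -(size_map s) E size_vals.
have ltm : nth 0 rs j < m by apply: lts; rewrite mem_nth ?sz.
have Ej : s (nth 0 rs j) = nth 0 (vals e) j by rewrite -E (nth_map 0) ?sz.
apply: within_eq (within_copy _ _ _ _ _ _) => //.
- by rewrite Z ?Ej.
- rewrite Ej leq_add2r leq_mul2l /= /poly_base.
  apply: (@leq_trans (sumn (vals e))); last by lia.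
  rewrite (sumnE (vals e)) (big_nth 0) size_vals big_mkord.
  by rewrite (bigD1 (Ordinal lt)) //= leq_addr.
- by rewrite neq_ltn ltm.
- by rewrite neq_ltn ltnSn.
- by rewrite neq_ltn ltnS ltnW.
- exact: Z.
Qed.

Lemma polytime_wk f : polytime f -> polytime (fun x y (e : ctx k.+1) => f x y e.1).
Proof.
move=> [c [b [[a Hb] H]]]; exists (fun rs m => c (behead rs) m), (fun x y e => b x y e.1).
split.
  exists a => x y e; apply: leq_trans (Hb _ _ _) _; apply: leq_expl.
  by rewrite /poly_base /= leq_add2r leq_add2l leq_addl.
move=> x y e [|r rs] m s m1 // /andP[_ lt] [_ E] s0 s1 Z.
exact: H.
Qed.

(** The test value sits in the result register. It is zero when [h] is chosen and is cleared before
    [g], so both branches start from the original state. *)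
Lemma polytime_if f g h : polytime f -> polytime g -> polytime h ->
  polytime (fun x y e => if 0 < f x y e then g x y e else h x y e).
Proof.
move=> Hf Hg Hh; have vf := polytime_bounded Hf.
move: Hf Hg Hh => [cf [bf [Bf Hf]]] [cg [bg [Bg Hg]]] [ch [bh [Bh Hh]]].
exists (fun rs m => Seq (cf rs m) (If m mark (ch rs m) (Seq (clear m) (cg rs m)))).
exists (fun x y e => bf x y e + (2 * f x y e + 1 + bg x y e + bh x y e + 1)).
split.
  by poly_bound.
move=> x y e rs m s m1 lt E s0 s1 Z.
have F := Hf x y _ _ _ _ m1 lt E s0 s1 Z; have {}Hg := Hg x y _ _ _ _ m1 lt E s0 s1 Z.
have {}Hh := Hh x y _ _ _ _ m1 lt E s0 s1 Z.
have Em v : upd (upd s m v) m 0 = s by rewrite upd_upd -(Z m) // upd_id.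
cbv beta; apply: (within_seq F); rewrite addn1; apply: within_if.
  rewrite cell_mark upd_same => /eqP E0; rewrite E0 ltnn.
  apply: within_le (_ : exec_within _ _ _ _ _ (bh x y e)); first by lia.
  by have := Em 0; rewrite upd_upd => ->.
rewrite cell_mark upd_same -lt0n => pos; rewrite pos.
have := within_clear x y m (upd s m (f x y e)); rewrite Em upd_same => C.
by apply: within_le (within_seq C Hg); lia.
Qed.

(** Register [m] counts down, [m.+1] holds the index, [m.+2] the current value and [m.+3] the next
    one. The time for [g] is polynomial in its arguments, so the bound [a] on the iterates makes it
    uniform; otherwise values might square in each round. *)
Lemma polytime_iter (n : seq bool -> seq bool -> ctx k -> nat)
    (F : seq bool -> seq bool -> ctx k -> nat -> nat)
    (g : seq bool -> seq bool -> ctx k.+2 -> nat) (a : seq bool -> seq bool -> ctx k -> nat) :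
  polytime n -> polytime (fun x y e => F x y e 0) -> polytime g ->
  (forall x y e i, F x y e i.+1 = g x y (e, i, F x y e i)) ->
  poly_bounded a -> (forall x y e i, i <= n x y e -> F x y e i <= a x y e) ->
  polytime (fun x y e => F x y e (n x y e)).
Proof.
move=> Hn H0 Hg FS Ba Fa; have vn := polytime_bounded Hn.
move: Hn H0 Hg => [cn [bn [Bn Hn]]] [c0 [b0 [B0 H0]]] [cg [bg [[d Bg] Hg]]].
(* Time for one evaluation of [g]: its context adds an index at most [n] and a value at most [a]. *)
pose T x y e := (poly_base x y e + n x y e + a x y e) ^ d.
exists (fun rs m => Seq (Seq (Seq (Seq (cn rs m) (c0 rs m.+2))
  (While m mark (Seq (Seq (Seq (Seq (Dec m) (cg [:: m.+2, m.+1 & rs] m.+3))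
     (clear m.+2)) (move_reg m.+3 m.+2)) (Inc m.+1))))
  (clear m.+1)) (move_reg m.+2 m)).
exists (fun x y e => bn x y e + b0 x y e +
  (n x y e * (T x y e + 2 * a x y e + 3 * a x y e + 5) + 1) +
  (2 * n x y e + 1) + (3 * a x y e + 1)).
split.
  by rewrite /T; poly_bound.
move=> x y e rs m s m1 lt E s0 s1 Z.
set N := n x y e; pose f := F x y e.
pose st i := upd (upd (upd s m (N - i)) m.+1 i) m.+2 (f i).
have lts : all (fun r => r < m.+3) rs by apply: sub_all lt => r; lia.
have other s' : (forall r, r < m -> s' r = s r) -> [seq s' r | r <- rs] = vals e.
  move=> Es; rewrite -E; apply/eq_in_map => r /(allP lt); exact: Es.
have Hn0 : exec_within x y (Seq (cn rs m) (c0 rs m.+2)) s (st 0) (bn x y e + b0 x y e).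
  apply: (within_seq (Hn x y _ _ _ _ m1 lt E s0 s1 Z)).
  apply: within_eq (H0 x y e rs m.+2 _ _ _ _ _ _ _) => //.
  - by have Z1 := Z m.+1 (leqnSn m); rewrite /st /f subn0; regs_eq.
  - by apply: sub_all lt => r; lia.
  - by apply: other => r lr; rewrite upd_other //; lia.
  - by rewrite upd_other //; lia.
  - by rewrite upd_other //; lia.
  - by move=> r lr; rewrite upd_other ?Z //; lia.
have stm i : st i m = N - i by rewrite /st; upd_simpl.
have st1 i : st i m.+1 = i by rewrite /st; upd_simpl.
have st2 i : st i m.+2 = f i by rewrite /st upd_same.
have sto i r : r < m \/ m.+2 < r -> st i r = s r.
  by move=> lr; rewrite /st; upd_simpl.
have fa i : i <= N -> f i <= a x y e by apply: Fa.
have body i : i < N -> exec_within x y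
    (Seq (Seq (Seq (Seq (Dec m) (cg [:: m.+2, m.+1 & rs] m.+3))
     (clear m.+2)) (move_reg m.+3 m.+2)) (Inc m.+1)) (st i) (st i.+1)
    (T x y e + 2 * a x y e + 3 * a x y e + 4).
  move=> iN.
  pose s2 := upd (st i) m (N - i.+1).
  have D : exec_within x y (Dec m) (st i) s2 1.
    apply: within_eq (within_dec x y _) => //; last by rewrite stm; lia.
    by rewrite /s2 stm subnS.
  have G : exec_within x y (cg [:: m.+2, m.+1 & rs] m.+3) s2 (upd s2 m.+3 (f i.+1))
      (T x y e).
    rewrite /f FS; apply: within_le (Hg x y _ _ _ _ _ _ _ _ _ _).
    - apply: leq_trans (Bg _ _ _) _; apply: leq_expl.
      have := fa i (ltnW iN); rewrite /poly_base /= /f; move: (sumn _) => u; lia.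
    - by lia.
    - by rewrite /= lts; lia.
    - rewrite /= /s2; upd_simpl; rewrite st1 st2.
      congr [:: _, _ & _]; apply: other => r lr.
      by upd_simpl; rewrite sto //; left.
    - by rewrite /s2; upd_simpl; rewrite sto //; lia.
    - by rewrite /s2; upd_simpl; rewrite sto //; lia.
    - by move=> r lr; rewrite /s2; upd_simpl; rewrite sto ?Z //; lia.
  have C := within_clear x y m.+2 (upd s2 m.+3 (f i.+1)).
  have M := @within_move x y m.+3 m.+2 (upd (upd s2 m.+3 (f i.+1)) m.+2 0).
  have I := within_inc x y m.+1.
  apply: within_eq (within_seq (within_seq (within_seq (within_seq D G) C) (M _)) (I _)).
  - have Z3 : s m.+3 = 0 by apply: Z; lia.
    by rewrite /s2 /st; regs_eq.
  - rewrite /s2; upd_simpl; rewrite st2.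
    have := fa i (ltnW iN); have := fa i.+1 iN; lia.
  - by lia.
have L := within_for (fun i _ => stm i) body.
have C := within_clear x y m.+1 (st N).
have M := @within_move x y m.+2 m (upd (st N) m.+1 0).
apply: within_eq (within_seq (within_seq (within_seq Hn0 L) C) (M _)).
- upd_simpl; rewrite st2 stm subnn.
  have Z1 : s m.+1 = 0 by apply: Z; lia.
  have Z2 : s m.+2 = 0 by apply: Z; lia.
  by rewrite /st; regs_eq.
- upd_simpl; rewrite st1 st2.
  have := fa N (leqnn N); rewrite -/N; move: (T x y e) (a x y e) => u v.
  by rewrite -[(_ + 4).+1]addnS; move: (N * _) => w; lia.
- by lia.
Qed.

End Closure.

(** * Reading the input words *)

Lemma cell_succ w v (a : option bool) :
  (cell w v.+1 == omap inl a) = (nth None (map Some w) v == a).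
Proof.
rewrite /cell; case: (ltnP v (size w)) => [lt|ge]; last first.
  by rewrite !nth_default ?size_map //; case: a.
by rewrite !(nth_map false) //; case: a.
Qed.

(** The head counts letters up to the first blank and then returns to the marker, since registers 0
    and 1 must be 0 between computations. *)
Lemma polytime_size h k : h < 2 ->
  polytime (fun x y (e : ctx k) => size (word_of x y h)).
Proof.
move=> h2.
exists (fun _ m => Seq (Seq (Inc h) (While h None (Seq (Inc h) (Inc m)))) (clear h)).
exists (fun x y e => 5 * poly_base x y e + 5); split; first by poly_bound.
move=> x y e rs m s m1 _ _ s0 s1 Z; set w := word_of x y h.
have sh : s h = 0 by case: h h2 {w} => [|[]].
have lew : size w <= poly_base x y e.
  rewrite /w /word_of /poly_base; case: h h2 {w sh} => [|[|//]] _ /=; lia.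
pose st i := upd (upd s m i) h i.+1.
have L : exec_within x y (While h None (Seq (Inc h) (Inc m)))
    (st 0) (st (size w)) (size w * 3).+1.
  apply: within_while => [i lt||i lt].
  - rewrite /st upd_same (@cell_succ _ _ None) (nth_map false) //.
  - by rewrite /st upd_same (@cell_succ _ _ None) nth_default // size_map.
  - apply: within_eq (within_seq (within_inc _ _ _ _) (within_inc _ _ _ _)) => //.
    by rewrite /st; regs_eq.
have I : exec_within x y (Inc h) s (st 0) 1.
  apply: within_eq (within_inc _ _ _ _) => //; have Zm := Z m (leqnn m).
  by rewrite /st; regs_eq.
apply: within_eq (within_seq (within_seq I L) (within_clear _ _ _ _)).
- by rewrite /st; regs_eq.
- by rewrite /st upd_same; lia.
Qed.

(** The head walks [f] cells past the first letter while [m.+1] records the way back. Beyond the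
    word it reads a blank, which counts as the default [false]. *)
Lemma polytime_nth h k (f : seq bool -> seq bool -> ctx k -> nat) : h < 2 ->
  polytime f -> polytime_pred (fun x y e => nth false (word_of x y h) (f x y e)).
Proof.
move=> h2 Hf; have vf := polytime_bounded Hf; move: Hf => [c [b [Hb Hc]]].
exists (fun rs m => Seq (Seq (Seq (Seq (Seq (c rs m) (Inc h))
  (While m mark (Seq (Seq (Dec m) (Inc m.+1)) (Inc h))))
  (If h (Some (inl true)) (Inc m) skip)) (Dec h))
  (While m.+1 mark (Seq (Dec m.+1) (Dec h)))).
exists (fun x y e => b x y e + (7 * f x y e + 10)); split; first by poly_bound.
move=> x y e rs m s m1 lt E s0 s1 Z; set w := word_of x y h.
have sh : s h = 0 by case: h h2 {w} => [|[]].
have Zm : s m = 0 by exact: Z.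
have Zm1 : s m.+1 = 0 by apply: Z.
have {}Hc := Hc x y _ _ _ _ m1 lt E s0 s1 Z.
set v := f x y e in Hc *; set r := nth false w v.
pose st i := upd (upd (upd s m (v - i)) m.+1 i) h i.+1.
(* On the way back, after one step that undoes the offset of the marker, register [m.+1] equals the
   head position. *)
pose st' i := upd (upd (upd s m r) m.+1 (v - i)) h (v - i).
have I : exec_within x y (Inc h) (upd s m v) (st 0) 1.
  by apply: within_eq (within_inc _ _ _ _) => //; rewrite /st; regs_eq.
have L : exec_within x y (While m mark (Seq (Seq (Dec m) (Inc m.+1)) (Inc h)))
    (st 0) (st v) (v * 4).+1.
  apply: within_for => i iv; first by rewrite /st; upd_simpl.
  apply: within_eq (within_seq (within_seq (within_dec _ _ _)
    (within_inc _ _ _ _)) (within_inc _ _ _ _)) => //.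
    by rewrite /st; regs_eq.
  by rewrite /st; upd_simpl; lia.
have B : exec_within x y (If h (Some (inl true)) (Inc m) skip) (st v)
    (upd (st v) m r) 3.
  have R : (cell w (st v h) == Some (inl true)) = r.
    rewrite /st upd_same (@cell_succ _ _ (Some true)) /r.
    case: (ltnP v (size w)) => [lv|ge]; last by rewrite !nth_default ?size_map.
    by rewrite (nth_map false) //; case: nth.
  apply: within_if; rewrite -/w R => Hr; rewrite ?Hr ?(negPf Hr) /=.
    apply: within_eq (within_inc _ _ _ _) => //.
    by rewrite /st; regs_eq.
  apply: within_eq (within_skip _ _ _) => //.
  by rewrite /st; regs_eq.
have D : exec_within x y (Dec h) (upd (st v) m r) (st' 0) 1.
  apply: within_eq (within_dec _ _ _) => //; first by rewrite /st /st'; regs_eq.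
  by rewrite /st; upd_simpl.
have L' : exec_within x y (While m.+1 mark (Seq (Dec m.+1) (Dec h)))
    (st' 0) (st' v) (v * 3).+1.
  apply: within_for => i iv; first by rewrite /st'; upd_simpl.
  apply: within_eq (within_seq (within_dec _ _ _) (within_dec _ _ _)) => //.
  - by rewrite /st'; regs_eq.
  - by rewrite /st'; upd_simpl; lia.
  - by rewrite /st'; upd_simpl; lia.
apply: within_eq (within_seq (within_seq (within_seq (within_seq
  (within_seq Hc I) L) B) D) L').
- by rewrite /st'; regs_eq.
- by lia.
Qed.

(** In the empty context the base is [size x + size y + 2], whence the polynomial. The result is
    computed in register 2, the first one not tied to an input word. *)
Lemma polytime_pred_rel (V : rel (seq bool)) :
  polytime_pred (fun x y (e : ctx 0) => V x y) -> polytime_rel V.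
Proof.
move=> [c [b [[a Hb] Hc]]].
apply: (@polytime_exec V (c [::] 2) 2 (('X + 2%:P) ^+ a)%R) => x y.
have [//|//|//|//|//|//|t E le] := Hc x y tt [::] 2 (fun=> 0).
exists (upd (fun=> 0) 2 (V x y)), t; split => //.
  apply: leq_trans le _; apply: leq_trans (Hb _ _ _) _.
  rewrite /poly_base /= addn0.
  by rewrite horner_exp hornerD hornerX hornerC.
by rewrite upd_same; case: (V x y).
Qed.

(** * Arithmetic, logic and bounded quantifiers *)

Lemma polytime_var0 k : polytime (fun x y (e : ctx k.+1) => e.2).
Proof. exact: (polytime_var _ 0). Qed.

Lemma polytime_var1 k : polytime (fun x y (e : ctx k.+2) => e.1.2).
Proof. exact: (polytime_var _ 1). Qed.

Lemma polytime_var2 k : polytime (fun x y (e : ctx k.+3) => e.1.1.2).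
Proof. exact: (polytime_var _ 2). Qed.

Section Arithmetic.
Variable k : nat.
Implicit Types (f g : seq bool -> seq bool -> ctx k -> nat).
Implicit Types (p q : seq bool -> seq bool -> ctx k -> bool).

(** The iteration discards its current value and returns the index: the predecessor of [i.+1] is
    [i]. *)
Lemma polytime_predn f : polytime f -> polytime (fun x y e => (f x y e).-1).
Proof.
move=> Hf; have vf := polytime_bounded Hf.
apply: (@polytime_iter k f (fun _ _ _ i => i.-1) (fun _ _ e => e.1.2) f) => //.
- exact: polytime_const.
- exact: polytime_var1.
- by move=> x y e i le; lia.
Qed.

Lemma polytime_add f g : polytime f -> polytime g ->
  polytime (fun x y e => f x y e + g x y e).
Proof.
move=> Hf Hg; have vf := polytime_bounded Hf; have vg := polytime_bounded Hg.
apply: (@polytime_iter k g (fun x y e i => f x y e + i) (fun _ _ e => e.2.+1)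
  (fun x y e => f x y e + g x y e)) => //.
- by apply: eq_polytime Hf => x y e; rewrite addn0.
- by apply: polytime_succ; apply: polytime_var0.
- by move=> x y e i /=; rewrite addnS.
- by poly_bound.
- by move=> x y e i le; lia.
Qed.

End Arithmetic.

Section Arithmetic2.
Variable k : nat.
Implicit Types (f g : seq bool -> seq bool -> ctx k -> nat).
Implicit Types (p q : seq bool -> seq bool -> ctx k -> bool).

Lemma polytime_sub f g : polytime f -> polytime g ->
  polytime (fun x y e => f x y e - g x y e).
Proof.
move=> Hf Hg; have vf := polytime_bounded Hf.
apply: (@polytime_iter k g (fun x y e i => f x y e - i) (fun _ _ e => e.2.-1) f) => //.
- by apply: eq_polytime Hf => x y e; rewrite subn0.
- by apply: polytime_predn; apply: polytime_var0.
- by move=> x y e i /=; rewrite subnS.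
- by move=> x y e i le; lia.
Qed.

Lemma polytime_mul f g : polytime f -> polytime g ->
  polytime (fun x y e => f x y e * g x y e).
Proof.
move=> Hf Hg; have vf := polytime_bounded Hf; have vg := polytime_bounded Hg.
apply: (@polytime_iter k g (fun x y e i => f x y e * i)
  (fun x y e => e.2 + f x y e.1.1) (fun x y e => f x y e * g x y e)) => //.
- by apply: eq_polytime (polytime_const _ 0) => x y e; rewrite muln0.
- by apply: polytime_add; [apply: polytime_var0|exact: (polytime_wk (polytime_wk Hf))].
- by move=> x y e i /=; rewrite mulnSr.
- by poly_bound.
- by move=> x y e i le; rewrite leq_mul.
Qed.

(** Every summand has index below [f], hence is bounded by a power of the base plus [f], and partial
    sums stay polynomially bounded. *)
Lemma polytime_sum f (h : seq bool -> seq bool -> ctx k -> nat -> nat) :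
  polytime f -> polytime (fun x y (e : ctx k.+1) => h x y e.1 e.2) ->
  polytime (fun x y e => \sum_(0 <= i < f x y e) h x y e i).
Proof.
move=> Hf Hh; have vf := polytime_bounded Hf; have [a vh] := polytime_bounded Hh.
apply: (@polytime_iter k f (fun x y e n => \sum_(0 <= i < n) h x y e i)
  (fun x y e => e.2 + h x y e.1.1 e.1.2)
  (fun x y e => f x y e * (poly_base x y e + f x y e) ^ a)) => //.
- by apply: eq_polytime (polytime_const _ 0) => x y e; rewrite big_geq.
- by apply: polytime_add; [apply: polytime_var0|exact: (polytime_wk Hh)].
- by move=> x y e i /=; rewrite big_nat_recr.
- by poly_bound.
- move=> x y e n le; apply: (@leq_trans (n * (poly_base x y e + f x y e) ^ a)).
    rewrite -[n in n * _]subn0 -sum_nat_const_nat !big_nat; apply: leq_sum => i /andP[_ lt].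
    apply: leq_trans (vh x y (e, i)) _; apply: leq_expl.
    by rewrite /poly_base /=; move: (sumn _) => u; lia.
  by rewrite leq_mul2r le orbT.
Qed.

Lemma polytime_cond p f g : polytime_pred p -> polytime f -> polytime g ->
  polytime (fun x y e => if p x y e then f x y e else g x y e).
Proof.
move=> Hp Hf Hg; apply: eq_polytime (polytime_if Hp Hf Hg) => x y e.
by rewrite lt0b.
Qed.

Lemma polytime_neg p : polytime_pred p -> polytime_pred (fun x y e => ~~ p x y e).
Proof.
move=> Hp.
apply: eq_polytime (polytime_cond Hp (polytime_const _ 0) (polytime_const _ 1)) => x y e.
by case: (p x y e).
Qed.

Lemma polytime_and p q : polytime_pred p -> polytime_pred q ->
  polytime_pred (fun x y e => p x y e && q x y e).
Proof.
move=> Hp Hq; apply: eq_polytime (polytime_mul Hp Hq) => x y e.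
by rewrite mulnb.
Qed.

Lemma polytime_or p q : polytime_pred p -> polytime_pred q ->
  polytime_pred (fun x y e => p x y e || q x y e).
Proof.
move=> Hp Hq; apply: eq_polytime (polytime_cond Hp (polytime_const _ 1) Hq) => x y e.
by case: (p x y e).
Qed.

Lemma polytime_gt0 f : polytime f -> polytime_pred (fun x y e => 0 < f x y e).
Proof.
move=> Hf.
apply: eq_polytime (polytime_if Hf (polytime_const _ 1) (polytime_const _ 0)) => x y e.
by case: ltnP.
Qed.

Lemma polytime_lt f g : polytime f -> polytime g ->
  polytime_pred (fun x y e => f x y e < g x y e).
Proof.
move=> Hf Hg; apply: eq_polytime (polytime_gt0 (polytime_sub Hg Hf)) => x y e.
by rewrite subn_gt0.
Qed.

Lemma polytime_le f g : polytime f -> polytime g ->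
  polytime_pred (fun x y e => f x y e <= g x y e).
Proof.
move=> Hf Hg; apply: eq_polytime (polytime_neg (polytime_lt Hg Hf)) => x y e.
by rewrite -leqNgt.
Qed.

Lemma polytime_eq f g : polytime f -> polytime g ->
  polytime_pred (fun x y e => f x y e == g x y e).
Proof.
move=> Hf Hg.
apply: eq_polytime (polytime_and (polytime_le Hf Hg) (polytime_le Hg Hf)) => x y e.
by rewrite eqn_leq.
Qed.

Lemma polytime_eqb p q : polytime_pred p -> polytime_pred q ->
  polytime_pred (fun x y e => p x y e == q x y e).
Proof.
move=> Hp Hq; apply: eq_polytime (polytime_eq Hp Hq) => x y e.
by case: (p x y e); case: (q x y e).
Qed.

Lemma polytime_min f g : polytime f -> polytime g ->
  polytime (fun x y e => minn (f x y e) (g x y e)).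
Proof. by move=> Hf Hg; apply: polytime_cond => //; apply: polytime_lt. Qed.

Lemma polytime_has f (h : seq bool -> seq bool -> ctx k -> nat -> bool) :
  polytime f -> polytime_pred (fun x y (e : ctx k.+1) => h x y e.1 e.2) ->
  polytime_pred (fun x y e => has (h x y e) (iota 0 (f x y e))).
Proof.
move=> Hf Hh.
have := @polytime_sum f (fun x y e i => nat_of_bool (h x y e i)) Hf Hh.
move/polytime_gt0; apply: eq_polytime => x y e.
rewrite has_count -sum1_count [in RHS]big_mkcond /=.
rewrite /index_iota subn0.
by congr (nat_of_bool (0 < _)); apply: eq_bigr => i _; case: h.
Qed.

End Arithmetic2.

Lemma polytime_all k f (h : seq bool -> seq bool -> ctx k -> nat -> bool) :
  polytime f -> polytime_pred (fun x y (e : ctx k.+1) => h x y e.1 e.2) ->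
  polytime_pred (fun x y e => all (h x y e) (iota 0 (f x y e))).
Proof.
move=> Hf Hh.
have := @polytime_has k f (fun x y e i => ~~ h x y e i) Hf (polytime_neg Hh).
by move/polytime_neg; apply: eq_polytime => x y e; rewrite has_predC negbK.
Qed.

Lemma polytime_odd k (f : seq bool -> seq bool -> ctx k -> nat) :
  polytime f -> polytime_pred (fun x y e => odd (f x y e)).
Proof.
move=> Hf; apply: (@polytime_iter k f (fun x y e n => nat_of_bool (odd n))
  (fun x y e => 1 - e.2) (fun _ _ _ => 1)) => //.
- exact: (polytime_const _ 0).
- by apply: polytime_sub; [apply: polytime_const|apply: polytime_var0].
- by move=> x y e i /=; case: odd.
- by poly_bound.
- by move=> x y e n _; case: odd.
Qed.

Lemma polytime_half k (f : seq bool -> seq bool -> ctx k -> nat) :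
  polytime f -> polytime (fun x y e => (f x y e)./2).
Proof.
move=> Hf; have vf := polytime_bounded Hf.
apply: (@polytime_iter k f (fun x y e n => n./2)
  (fun x y e => odd e.1.2 + e.2) f) => //.
- exact: (polytime_const _ 0).
- apply: polytime_add; last exact: polytime_var0.
  by apply: polytime_odd; apply: polytime_var1.
- by move=> x y e i /=; rewrite uphalf_half.
- by move=> x y e n; lia.
Qed.

(** The power of 2 may be exponentially large, so it is never formed; halving is repeated
    instead. *)
Lemma polytime_div_expn2 k (f g : seq bool -> seq bool -> ctx k -> nat) :
  polytime f -> polytime g -> polytime (fun x y e => f x y e %/ 2 ^ g x y e).
Proof.
move=> Hf Hg; have vf := polytime_bounded Hf.
apply: (@polytime_iter k g (fun x y e n => f x y e %/ 2 ^ n)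
  (fun x y e => e.2./2) f) => //.
- by apply: eq_polytime Hf => x y e; rewrite divn1.
- by apply: polytime_half; apply: polytime_var0.
- by move=> x y e i /=; rewrite expnSr divnMA divn2.
- by move=> x y e n _; apply: leq_div.
Qed.

(** * The verifier *)

Section Verifier.
Variables x y : seq bool.

(** It exceeds twice the dimension of any matrix encoded by [x], so it bounds indices and exponents
    alike. *)
Definition stride : nat := (size x).+1.

(* The certificate is read as seven tables: the signs (0) and the unary absolute
   values (1) of the b_ij, the signs (2) of the c_ij, the signs (3) and bits (4) of
   the l_ik, and the unary exponents a_i (5) and b_i (6). *)
Definition cert (t i j b : nat) : bool :=
  nth false y (((t * stride + i) * stride + j) * (stride * stride) + b).

Definition bneg (i j : nat) : bool := cert 0 i j 0.
(** Three cells are added up, so the value is at most 3 for every certificate. *)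
Definition babs (i j : nat) : nat := cert 1 i j 0 + cert 1 i j 1 + cert 1 i j 2.
Definition cneg (i j : nat) : bool := (i != j) && cert 2 i j 0.
Definition cabs (i j : nat) : nat := if i == j then 2 else babs i j.
Definition lneg (i k : nat) : bool := cert 3 i k 0.
Definition lbit (i k b : nat) : bool := cert 4 i k b.
Definition two_exp (i : nat) : nat := \sum_(0 <= v < stride) cert 5 i v 0.
Definition three_exp (i : nat) : nat := \sum_(0 <= v < stride) cert 6 i v 0.

(** Number of binary digits of [n], counted as the powers of 2 that are at most [n]. *)
Definition nbits (n : nat) : nat := \sum_(0 <= i < n) (0 < n %/ 2 ^ i).

(** Code length of an integer of absolute value [a <= 3]: a sign, two letters per binary digit and
    the end mark. *)
Definition esize (a : nat) : nat := if a == 0 then 2 else if a == 1 then 4 else 6.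

(** Letter [t] of that code. Zero carries no minus sign; letter 3 is the end mark if [a] is 1 and
    announces a second digit if [a] is 2 or 3. *)
Definition eletter (neg : bool) (a t : nat) : bool :=
  if t == 0 then neg && (0 < a) else
  if t == 1 then 0 < a else
  if t == 2 then (a == 1) || (a == 3) else
  if t == 5 then false else 1 < a.

Definition row_size (n i : nat) : nat := \sum_(0 <= j < n) esize (babs i j).

Definition check_header (n : nat) : bool :=
  all (fun t => nth false x (2 * t) &&
                (nth false x (2 * t + 1) == odd (n %/ 2 ^ t))) (iota 0 (nbits n))
  && ~~ nth false x (2 * nbits n).

Definition check_entry (n i j : nat) : bool :=
  all (fun t => nth false x (2 * nbits n + 1 + (\sum_(0 <= i' < i) row_size n i')
                  + (\sum_(0 <= j' < j) esize (babs i j')) + t)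
                == eletter (bneg i j) (babs i j) t)
    (iota 0 (esize (babs i j))).

Definition check_word (n : nat) : bool :=
  [&& size x == 2 * nbits n + 1 + \sum_(0 <= i < n) row_size n i,
      check_header n &
      all (fun i => all (check_entry n i) (iota 0 n)) (iota 0 n)].

(** In 1, 2 and 3 the exponents of the primes 2 and 3 are the indicators of these values, so the
    last two equations say d_i |b_ij| = d_j |b_ji| without forming d_i. *)
Definition check_sym (i j : nat) : bool :=
  if (babs i j == 0) && (babs j i == 0) then true else
  [&& 0 < babs i j, 0 < babs j i, bneg i j == ~~ bneg j i, cneg i j == cneg j i,
      two_exp i + (babs i j == 2) == two_exp j + (babs j i == 2) &
      three_exp i + (babs i j == 3) == three_exp j + (babs j i == 3)].

Definition nlbits : nat := stride * stride.

(** The bits of weight [2 ^ b] in row [i] of L contribute [pos_digit - neg_digit] times [2 ^ b] to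
    (L C)_ij. Such a digit need not be 0 or 1. *)
Definition pos_digit (i j b : nat) : nat :=
  \sum_(0 <= k < i.+1) lbit i k b * cabs k j * (lneg i k == cneg k j).

Definition neg_digit (i j b : nat) : nat :=
  \sum_(0 <= k < i.+1) lbit i k b * cabs k j * (lneg i k == ~~ cneg k j).

(** A digit is a sum of at most [stride] terms of absolute value at most 3. Past this bound doubling
    outweighs any later digit, so the sign is settled. *)
Definition cap : nat := 3 * stride.

(* Horner evaluation of the binary expansion of an entry of [L C], clamped to
   [-cap, cap] and shifted by [cap]. *)
Fixpoint clamped (i j m : nat) : nat :=
  if m is m'.+1 then
    minn (2 * cap) ((2 * clamped i j m' + pos_digit i j (nlbits - m)) -
                    (neg_digit i j (nlbits - m) + cap))
  else cap.

Definition check_row (i : nat) : bool :=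
  [&& ~~ lneg i i, has (lbit i i) (iota 0 nlbits),
      all (fun j => clamped i j nlbits == cap) (iota 0 i) &
      cap < clamped i i nlbits].

Definition verifier_at (n : nat) : bool :=
  [&& 0 < n, check_word n, all (fun i => all (check_sym i) (iota 0 n)) (iota 0 n) &
      all check_row (iota 0 n)].

(** The dimension is found by exhaustive search, which avoids decoding [x]. *)
Definition verifier : bool := has verifier_at (iota 0 stride).

End Verifier.

(** * Running time of the verifier *)

Lemma polytime_ifb k (p q r : seq bool -> seq bool -> ctx k -> bool) :
  polytime_pred p -> polytime_pred q -> polytime_pred r ->
  polytime_pred (fun x y e => if p x y e then q x y e else r x y e).
Proof.
move=> Hp Hq Hr; apply: eq_polytime (polytime_cond Hp Hq Hr) => x y e.
by case: (p x y e).
Qed.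

Lemma polytime_bool k (b : bool) : polytime_pred (fun x y (e : ctx k) => b).
Proof. exact: polytime_const. Qed.

Ltac polytime_hyp :=
  match goal with
  | H : _ |- _ =>
    first [exact: H | exact: (polytime_wk H) | exact: (polytime_wk (polytime_wk H))
          | exact: (polytime_wk (polytime_wk (polytime_wk H)))]
  end.

Ltac polytime_step :=
  first
  [ match goal with
    | |- polytime (fun x y e => _ + _) => apply: polytime_add
    | |- polytime (fun x y e => _ - _) => apply: polytime_sub
    | |- polytime (fun x y e => _ * _) => apply: polytime_mul
    | |- polytime (fun x y e => _ %/ 2 ^ _) => apply: polytime_div_expn2
    | |- polytime (fun x y e => minn _ _) => apply: polytime_min
    | |- polytime (fun x y e => _.+1) => apply: polytime_succ
    | |- polytime (fun x y e => nat_of_bool (@?p x y e)) => change (polytime_pred p)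
    | |- polytime (fun x y e => if _ then _ else _) => apply: polytime_cond
    | |- polytime_pred (fun x y e => if _ then _ else _) => apply: polytime_ifb
    | |- polytime_pred (fun x y e => @eq_op nat _ _) => apply: polytime_eq
    | |- polytime_pred (fun x y e => @eq_op _ _ _) =>
        first [apply: polytime_eq | apply: polytime_eqb]
    | |- polytime_pred (fun x y e => all _ _) => apply: polytime_all
    | |- polytime_pred (fun x y e => has _ _) => apply: polytime_has
    | |- polytime_pred (fun x y e => odd _) => apply: polytime_odd
    | |- polytime_pred (fun x y e => _ && _) => apply: polytime_and
    | |- polytime_pred (fun x y e => _ || _) => apply: polytime_or
    | |- polytime_pred (fun x y e => ~~ _) => apply: polytime_neg
    | |- polytime_pred (fun x y e => _ < _) => apply: polytime_lt
    | |- polytime_pred (fun x y e => _ <= _) => apply: polytime_le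
    end
  | polytime_hyp | exact: polytime_var0 | exact: polytime_var1 | exact: polytime_var2
  | exact: polytime_const | exact: polytime_bool | apply: polytime_sum ].

Section VerifierPolytime.
Variable k : nat.
Implicit Types f g h : seq bool -> seq bool -> ctx k -> nat.

Lemma polytime_stride : polytime (fun x y (e : ctx k) => stride x).
Proof. by apply: polytime_succ; apply: (@polytime_size 0). Qed.

Lemma polytime_nth_x f : polytime f -> polytime_pred (fun x y e => nth false x (f x y e)).
Proof. exact: (@polytime_nth 0). Qed.

Lemma polytime_cert t f g h : polytime f -> polytime g -> polytime h ->
  polytime_pred (fun x y e => cert x y t (f x y e) (g x y e) (h x y e)).
Proof.
move=> Hf Hg Hh; apply: (@polytime_nth 1) => //; have Hs := polytime_stride.
by repeat polytime_step.
Qed.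

End VerifierPolytime.

Section Steps.
Variable k : nat.
Implicit Types f g h : seq bool -> seq bool -> ctx k -> nat.
Implicit Types p : seq bool -> seq bool -> ctx k -> bool.

Lemma polytime_bneg f g : polytime f -> polytime g ->
  polytime_pred (fun x y e => bneg x y (f x y e) (g x y e)).
Proof. by move=> *; apply: polytime_cert; repeat polytime_step. Qed.

Lemma polytime_babs f g : polytime f -> polytime g ->
  polytime (fun x y e => babs x y (f x y e) (g x y e)).
Proof. by move=> *; rewrite /babs; repeat first [apply: polytime_cert|polytime_step]. Qed.

Lemma polytime_cneg f g : polytime f -> polytime g ->
  polytime_pred (fun x y e => cneg x y (f x y e) (g x y e)).
Proof.
move=> *; rewrite /cneg; repeat first [apply: polytime_cert|apply: polytime_eq|polytime_step].
Qed.

Lemma polytime_cabs f g : polytime f -> polytime g ->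
  polytime (fun x y e => cabs x y (f x y e) (g x y e)).
Proof.
by move=> *; rewrite /cabs; repeat first [apply: polytime_babs|apply: polytime_eq|polytime_step].
Qed.

Lemma polytime_two_exp f : polytime f -> polytime (fun x y e => two_exp x y (f x y e)).
Proof.
move=> *; rewrite /two_exp.
by repeat first [apply: polytime_cert|apply: polytime_stride|polytime_step].
Qed.

Lemma polytime_three_exp f : polytime f -> polytime (fun x y e => three_exp x y (f x y e)).
Proof.
move=> *; rewrite /three_exp.
by repeat first [apply: polytime_cert|apply: polytime_stride|polytime_step].
Qed.

Lemma polytime_nbits f : polytime f -> polytime (fun x y e => nbits (f x y e)).
Proof. by move=> *; rewrite /nbits; repeat polytime_step. Qed.

Lemma polytime_esize f : polytime f -> polytime (fun x y e => esize (f x y e)).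
Proof. by move=> *; rewrite /esize; repeat first [apply: polytime_eq|polytime_step]. Qed.

Lemma polytime_eletter p f g : polytime_pred p -> polytime f -> polytime g ->
  polytime_pred (fun x y e => eletter (p x y e) (f x y e) (g x y e)).
Proof.
move=> *; rewrite /eletter; repeat polytime_step.
Qed.

End Steps.

Section Rows.
Variable k : nat.
Implicit Types f g h : seq bool -> seq bool -> ctx k -> nat.

Lemma polytime_row_size f g : polytime f -> polytime g ->
  polytime (fun x y e => row_size x y (f x y e) (g x y e)).
Proof.
move=> *; rewrite /row_size.
by repeat first [apply: polytime_esize|apply: polytime_babs|polytime_step].
Qed.

Lemma polytime_check_header f : polytime f ->
  polytime_pred (fun x y e => check_header x (f x y e)).
Proof.
move=> *; rewrite /check_header.
by repeat first [apply: polytime_nth_x|apply: polytime_nbits|polytime_step].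
Qed.

End Rows.

Section Checks.
Variable k : nat.
Implicit Types f g h : seq bool -> seq bool -> ctx k -> nat.

Lemma polytime_check_entry f g h : polytime f -> polytime g -> polytime h ->
  polytime_pred (fun x y e => check_entry x y (f x y e) (g x y e) (h x y e)).
Proof.
move=> *; rewrite /check_entry.
by repeat first [apply: polytime_nth_x|apply: polytime_nbits|apply: polytime_esize
  |apply: polytime_babs|apply: polytime_row_size|apply: polytime_eletter
  |apply: polytime_bneg|polytime_step].
Qed.

Lemma polytime_check_sym f g : polytime f -> polytime g ->
  polytime_pred (fun x y e => check_sym x y (f x y e) (g x y e)).
Proof.
move=> *; rewrite /check_sym.
by repeat first [apply: polytime_babs|apply: polytime_bneg|apply: polytime_cneg
  |apply: polytime_two_exp|apply: polytime_three_exp|polytime_step].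
Qed.

Lemma polytime_lneg f g : polytime f -> polytime g ->
  polytime_pred (fun x y e => lneg x y (f x y e) (g x y e)).
Proof. by move=> *; apply: polytime_cert; repeat polytime_step. Qed.

Lemma polytime_lbit f g h : polytime f -> polytime g -> polytime h ->
  polytime_pred (fun x y e => lbit x y (f x y e) (g x y e) (h x y e)).
Proof. by move=> *; apply: polytime_cert; repeat polytime_step. Qed.

Lemma polytime_nlbits : polytime (fun x y (e : ctx k) => nlbits x).
Proof. by apply: polytime_mul; apply: polytime_stride. Qed.

Lemma polytime_cap : polytime (fun x y (e : ctx k) => cap x).
Proof. by apply: polytime_mul; [apply: polytime_const|apply: polytime_stride]. Qed.

End Checks.

Section Digits.
Variable k : nat.
Implicit Types f g h : seq bool -> seq bool -> ctx k -> nat.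

Lemma polytime_pos_digit f g h : polytime f -> polytime g -> polytime h ->
  polytime (fun x y e => pos_digit x y (f x y e) (g x y e) (h x y e)).
Proof.
move=> *; rewrite /pos_digit.
by repeat first [apply: polytime_lbit|apply: polytime_cabs|apply: polytime_lneg
  |apply: polytime_cneg|polytime_step].
Qed.

Lemma polytime_neg_digit f g h : polytime f -> polytime g -> polytime h ->
  polytime (fun x y e => neg_digit x y (f x y e) (g x y e) (h x y e)).
Proof.
move=> *; rewrite /neg_digit.
by repeat first [apply: polytime_lbit|apply: polytime_cabs|apply: polytime_lneg
  |apply: polytime_cneg|polytime_step].
Qed.

End Digits.

Lemma clamped_le x y i j m : clamped x y i j m <= 2 * cap x.
Proof. by case: m => [|m] /=; [rewrite mul2n -addnn leq_addr|apply: geq_minl]. Qed.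

(** Clamping keeps the iterated value at most [2 * cap], although the entry of L C itself may have
    polynomially many bits. *)
Lemma polytime_clamped k (f g h : seq bool -> seq bool -> ctx k -> nat) :
  polytime f -> polytime g -> polytime h ->
  polytime (fun x y e => clamped x y (f x y e) (g x y e) (h x y e)).
Proof.
move=> Hf Hg Hh.
have Hb := polytime_bounded (polytime_mul (polytime_const k 2) (polytime_cap k)).
apply: (@polytime_iter k h (fun x y e m => clamped x y (f x y e) (g x y e) m)
  (fun x y e => minn (2 * cap x)
    ((2 * e.2 + pos_digit x y (f x y e.1.1) (g x y e.1.1) (nlbits x - e.1.2.+1))
     - (neg_digit x y (f x y e.1.1) (g x y e.1.1) (nlbits x - e.1.2.+1) + cap x)))
  (fun x y e => 2 * cap x)) => //.
- exact: polytime_cap.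
- by repeat first [apply: polytime_pos_digit|apply: polytime_neg_digit
    |apply: polytime_cap|apply: polytime_nlbits|polytime_step].
- by move=> x y e m _; apply: clamped_le.
Qed.

Lemma polytime_check_row k (f : seq bool -> seq bool -> ctx k -> nat) :
  polytime f -> polytime_pred (fun x y e => check_row x y (f x y e)).
Proof.
move=> *; rewrite /check_row.
by repeat first [apply: polytime_lneg|apply: polytime_lbit|apply: polytime_clamped
  |apply: polytime_cap|apply: polytime_nlbits|polytime_step].
Qed.

Lemma polytime_verifier : polytime_rel verifier.
Proof.
apply: polytime_pred_rel; rewrite /verifier /verifier_at /check_word.
repeat first [apply: polytime_check_row|apply: polytime_check_sym|apply: polytime_check_entry
  |apply: polytime_check_header|apply: polytime_row_size|apply: polytime_nbits
  |apply: polytime_stride|apply: (@polytime_size 0)|polytime_step].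
by [].
Qed.

(** * Encoding *)

(** [2 ^ i <= n] holds exactly for [i < up_log 2 n.+1], and this logarithm is at most [n], so
    counting below [n] misses nothing. *)
Lemma nbitsE n : nbits n = up_log 2 n.+1.
Proof.
rewrite /nbits; set e := up_log 2 n.+1.
have le : e <= n by apply: up_log_min => //; apply: ltn_expl.
have E i : (0 < n %/ 2 ^ i) = (i < e).
  rewrite divn_gt0 ?expn_gt0 // ltnNge.
  apply/idP/idP => [le'|].
    apply/negP => ei; have : n.+1 <= 2 ^ i.
      by apply: leq_trans (up_logP n.+1 (isT : 1 < 2)) _; rewrite leq_exp2l.
    by rewrite ltnNge le'.
  by move/negP => ne; rewrite leqNgt; apply/negP => lt; apply: ne; apply: up_log_min.
under eq_bigr => i _ do rewrite E.
rewrite (@big_cat_nat _ _ _ e) //= big_nat.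
rewrite (eq_bigr (fun=> 1)) => [|i /andP[_ ->]] //.
rewrite -big_nat sum_nat_const_nat subn0 muln1.
rewrite big_nat (eq_bigr (fun=> 0)) => [|i /andP[ei _]]; last by rewrite ltnNge ei.
by rewrite -big_nat big1_eq addn0.
Qed.

Lemma eletterE neg a : a <= 3 ->
  encode_int (if neg then - a%:Z else a%:Z)%R = mkseq (eletter neg a) (esize a).
Proof. by case: a neg => [|[|[|[|//]]]] [] _. Qed.

(** Positions past the end of [x] read as [false], so equality of words needs a separate comparison
    of lengths. *)
Definition occurs (x : seq bool) (o : nat) (w : seq bool) :=
  all (fun t => nth false x (o + t) == nth false w t) (iota 0 (size w)).

Lemma occursP x o w :
  reflect (forall t, t < size w -> nth false x (o + t) = nth false w t) (occurs x o w).
Proof.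
apply: (iffP allP) => [H t lt|H t].
  by apply/eqP/H; rewrite mem_iota.
by rewrite mem_iota => /H ->.
Qed.

Lemma occurs_eq x w : (x == w) = (size x == size w) && occurs x 0 w.
Proof.
apply/eqP/andP => [->|[/eqP E /occursP H]].
  by split=> //; apply/occursP.
by apply: (@eq_from_nth _ false) => // t; rewrite E => /H.
Qed.

Lemma occurs_cat x o u v :
  occurs x o (u ++ v) = occurs x o u && occurs x (o + size u) v.
Proof.
apply/occursP/andP => [H|[/occursP Hu /occursP Hv] t].
  split; apply/occursP => t lt.
    by rewrite H ?nth_cat ?lt // size_cat ltn_addr.
  by rewrite -addnA H ?size_cat ?ltn_add2l // nth_cat ltnNge leq_addr addKn.
rewrite size_cat nth_cat; case: (ltnP t (size u)) => [lt|ge lt]; first by rewrite Hu.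
by rewrite -(Hv (t - size u)) -?addnA ?subnKC //; move: ge lt; lia.
Qed.

Lemma size_flatten_iota (f : nat -> seq bool) n :
  size (flatten [seq f i | i <- iota 0 n]) = \sum_(0 <= i < n) size (f i).
Proof. by rewrite size_flatten sumnE /shape -map_comp big_map /index_iota subn0. Qed.

Lemma occurs_flatten x o (f : nat -> seq bool) n :
  occurs x o (flatten [seq f i | i <- iota 0 n]) =
  all (fun i => occurs x (o + \sum_(0 <= i' < i) size (f i')) (f i)) (iota 0 n).
Proof.
elim: n => // n IH; rewrite -addn1 iotaD map_cat flatten_cat occurs_cat all_cat IH.
by rewrite size_flatten_iota /= cats0 andbT.
Qed.

Definition bval x y i j : int :=
  (if bneg x y i j then - (babs x y i j)%:Z else (babs x y i j)%:Z)%R.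

Lemma babs_le3 x y i j : babs x y i j <= 3.
Proof. by rewrite /babs; do 3!case: cert. Qed.

Lemma encode_mxE n (f : nat -> nat -> int) :
  encode_mx (\matrix_(i < n, j < n) f i j)%R = encode_nat n ++
  flatten [seq flatten [seq encode_int (f i j) | j <- iota 0 n] | i <- iota 0 n].
Proof.
rewrite /encode_mx; congr (_ ++ _).
rewrite -val_enum_ord -map_comp.
elim: {2 4}(enum _) => //= i s <-; rewrite flatten_cat -map_comp.
by congr (flatten _ ++ _); apply: eq_map => j /=; rewrite mxE.
Qed.

Lemma check_headerE x n :
  check_header x n = occurs x 0 (encode_nat n).
Proof.
rewrite /check_header /encode_nat occurs_cat add0n.
have szf (s : seq bool) : size (flatten [seq [:: true; b] | b <- s]) = 2 * size s.
  by elim: s => //= b s ->; rewrite mulnS.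
have -> : size (flatten [seq [:: true; b] | b <- bits n]) = 2 * nbits n.
  by rewrite szf size_mkseq nbitsE.
congr andb; last by rewrite /occurs /= addn0 andbT; case: nth.
rewrite /bits -nbitsE /mkseq -map_comp occurs_flatten; apply: eq_all => t /=.
rewrite sum_nat_const_nat subn0 add0n mulnC.
by rewrite /occurs /= addn0 andbT; case: nth.
Qed.

(** The certificate determines the lengths of all blocks, so each entry is compared at an offset
    that is a sum of earlier lengths. *)
Lemma check_wordE x y n :
  check_word x y n = (x == encode_mx (\matrix_(i < n, j < n) bval x y i j)%R).
Proof.
have Ee i j : encode_int (bval x y i j) =
    mkseq (eletter (bneg x y i j) (babs x y i j)) (esize (babs x y i j)).
  exact/eletterE/babs_le3.
have Er i : size (flatten [seq encode_int (bval x y i j) | j <- iota 0 n]) =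
    row_size x y n i.
  by rewrite size_flatten_iota; apply: eq_bigr => j _; rewrite Ee size_mkseq.
have Eh : size (encode_nat n) = 2 * nbits n + 1.
  rewrite /encode_nat size_cat nbitsE; congr (_ + _); rewrite /bits.
  elim: (up_log _ _) => // k IH.
  by rewrite mkseqS map_rcons flatten_rcons size_cat IH /= mulnS addnC.
rewrite encode_mxE occurs_eq /check_word size_cat Eh size_flatten_iota.
under [in RHS]eq_bigr => i _ do rewrite Er.
rewrite occurs_cat -check_headerE occurs_flatten add0n Eh.
congr [&& _, _ & _]; apply: eq_in_all => i _.
rewrite occurs_flatten; apply: eq_in_all => j _.
rewrite /check_entry /occurs Ee size_mkseq; apply: eq_in_all => t.
rewrite mem_iota => lt; rewrite nth_mkseq //.
congr (nth _ _ (_ + _ + _ + _) == _).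
  by apply: eq_bigr => i' _; rewrite Er.
by apply: eq_bigr => j' _; rewrite Ee size_mkseq.
Qed.

(** * Clamped Horner evaluation *)

Section Horner.
Variables (x y : seq bool).
Local Open Scope ring_scope.

Definition cval k j : int :=
  if cneg x y k j then - (cabs x y k j)%:Z else (cabs x y k j)%:Z.

Definition lval i k : int :=
  (if lneg x y i k then -1 else 1) * \sum_(0 <= b < nlbits x) (lbit x y i k b)%:Z * 2 ^+ b.

Definition digit i j b : int := (pos_digit x y i j b)%:Z - (neg_digit x y i j b)%:Z.

Lemma digitE i j b : digit i j b =
  \sum_(0 <= k < i.+1) (if lneg x y i k then -1 else 1) * (lbit x y i k b)%:Z * cval k j.
Proof.
rewrite /digit /pos_digit /neg_digit !(big_morph Posz PoszD (erefl 0%:Z)) -sumrB.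
apply: eq_bigr => k _.
rewrite /cval; case: (lbit x y i k b); case: lneg; case: cneg => /=; lia.
Qed.

Lemma cabs_le3 k j : (cabs x y k j <= 3)%N.
Proof. by rewrite /cabs; case: ifP => // _; apply: babs_le3. Qed.

Lemma pos_digit_le i j b : (i < stride x)%N ->
  (pos_digit x y i j b + neg_digit x y i j b <= cap x)%N.
Proof.
move=> lt; rewrite /pos_digit /neg_digit -big_split /=.
apply: (@leq_trans (\sum_(0 <= k < i.+1) 3)%N).
  apply: leq_sum => k _; have := cabs_le3 k j.
  by case: lbit; case: lneg; case: cneg => /=; lia.
by rewrite sum_nat_const_nat /cap; lia.
Qed.

(** Induction on the number of leading digits read. An exact value is updated exactly unless it
    leaves the window. A saturated one has |t| > c, and 2 t + d stays outside on the same side for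
    every digit |d| <= c. *)
Lemma clampedE i j m : (i < stride x)%N -> (m <= nlbits x)%N ->
  let t := \sum_(0 <= b < m) digit i j (nlbits x - m + b) * 2 ^+ b in
  let h := (clamped x y i j m)%:Z in let c := (cap x)%:Z in
  (- c <= t <= c) /\ h = t + c \/ (c < t /\ h = c + c \/ t < - c /\ h = 0).
Proof.
move=> lti; elim: m => [|m IH] lem.
  by rewrite big_geq //=; left; split; lia.
move: (IH (ltnW lem)); cbv zeta; rewrite [clamped _ _ _ _ m.+1]/=.
(* Horner step: the new digit enters with weight 1 and the earlier ones are doubled. *)
have -> : \sum_(0 <= b < m.+1) digit i j (nlbits x - m.+1 + b) * 2 ^+ b =
    digit i j (nlbits x - m.+1) +
    2 * \sum_(0 <= b < m) digit i j (nlbits x - m + b) * 2 ^+ b.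
  rewrite big_nat_recl // addn0 mulr1; congr (_ + _).
  rewrite mulr_sumr; apply: eq_bigr => b _.
  rewrite exprS mulrCA; congr (_ * (digit _ _ _ * _)); lia.
move: (\sum_(_ <= _ < _) _) => t; rewrite /digit.
move: (pos_digit_le j (nlbits x - m.+1) lti).
move: (pos_digit x y i j _) (neg_digit x y i j _) (clamped x y i j m) (cap x) => p q h c le.
(* The cases decide [minn], the upper clamp; truncated subtraction is the lower one. *)
have [lo|hi] := leqP (2 * c)%N (2 * h + p - (q + c))%N.
  move=> -[[H E]|[[H E]|[H E]]]; lia.
move=> -[[H E]|[[H E]|[H E]]]; lia.
Qed.

Lemma sum_digit i j : \sum_(0 <= b < nlbits x) digit i j b * 2 ^+ b =
  \sum_(0 <= k < i.+1) lval i k * cval k j.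
Proof.
under eq_bigr => b _ do rewrite digitE mulr_suml.
rewrite exchange_big /=; apply: eq_bigr => k _.
rewrite /lval mulr_sumr mulr_suml; apply: eq_bigr => b _.
by rewrite !mulrA; rewrite mulrAC.
Qed.

Lemma clamped_sign i j : (i < stride x)%N ->
  (clamped x y i j (nlbits x) == cap x) = (\sum_(0 <= k < i.+1) lval i k * cval k j == 0) /\
  (cap x < clamped x y i j (nlbits x))%N = (0 < \sum_(0 <= k < i.+1) lval i k * cval k j).
Proof.
move=> lti; have := @clampedE i j (nlbits x) lti (leqnn _); cbv zeta.
rewrite subnn -sum_digit; move: (\sum_(_ <= _ < _) _) => t.
have : (0 < cap x)%N by [].
by move: (clamped _ _ _ _ _) (cap x) => h c c0 [[]|[[]|[]]]; lia.
Qed.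

End Horner.

(** * Soundness *)

Section PositiveDefinite.
Local Open Scope ring_scope.
Variable F : realFieldType.

(** [L *m A *m L^T] is a product of the upper triangular matrices [L *m A] and [L^T]. Being
    symmetric it is diagonal, with positive entries, and [v = L^T *m w] turns the form into a
    positively weighted sum of squares. *)
Lemma posdefmx_lower n (A L : 'M[F]_n) : A^T = A ->
  (forall i j : 'I_n, (i < j)%N -> L i j = 0) -> (forall i, 0 < L i i) ->
  (forall i j : 'I_n, (j < i)%N -> (L *m A) i j = 0) ->
  (forall i, 0 < (L *m A) i i) -> posdefmx A.
Proof.
move=> symA trigL posL trigLA posLA v v0.
have unitL : L^T \in unitmx.
  rewrite unitmx_tr unitmxE det_trig; last exact/is_trig_mxP.
  by rewrite unitfE prodf_seq_neq0; apply/allP => i _; rewrite /= gt_eqF.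
pose w := invmx L^T *m v.
have vE : v = L^T *m w by rewrite mulKVmx.
have w0 : w != 0 by apply: contra_neq v0 => w0; rewrite vE w0 mulmx0.
pose E := L *m A *m L^T.
have symE : E^T = E by rewrite /E !trmx_mul trmxK symA mulmxA.
have trigE (i j : 'I_n) : (j < i)%N -> E i j = 0.
  move=> lt; rewrite mxE big1 // => k _; rewrite [L^T _ _]mxE.
  have [ki|ik] := ltnP k i; first by rewrite trigLA ?mul0r.
  by rewrite trigL ?mulr0 //; apply: leq_trans ik.
have diagE (i j : 'I_n) : i != j -> E i j = 0.
  rewrite neq_ltn => /orP[lt|]; last exact: trigE.
  by rewrite -symE mxE trigE.
have posE i : 0 < E i i.
  rewrite mxE (bigD1 i) //= big1 => [|k neq].
    by rewrite addr0 [L^T _ _]mxE mulr_gt0.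
  rewrite [L^T _ _]mxE; move: neq; rewrite neq_ltn => /orP[ki|ik].
    by rewrite trigLA ?mul0r.
  by rewrite trigL ?mulr0.
have -> : v^T *m A *m v = w^T *m E *m w.
  by rewrite vE /E !trmx_mul trmxK !mulmxA.
rewrite mxE (eq_bigr (fun i => w i 0 ^+ 2 * E i i)); last first.
  move=> i _; rewrite mxE (bigD1 i) //= big1 => [|k neq].
    by rewrite addr0 [w^T _ _]mxE mulrAC expr2.
  by rewrite diagE ?mulr0.
have [i wi] : exists i, w i 0 != 0.
  apply/existsP; apply: contraR w0; rewrite negb_exists => /forallP H.
  by apply/eqP/matrixP => i j; rewrite ord1 [RHS]mxE; apply/eqP; have := H i; rewrite negbK.
rewrite (bigD1 i) //= ltr_pwDl //; first by rewrite mulr_gt0 // exprn_even_gt0.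
by apply: sumr_ge0 => k _; rewrite mulr_ge0 ?sqr_ge0 // ltW.
Qed.

End PositiveDefinite.

Section DiagonalScaling.
Local Open Scope ring_scope.
Variable n : nat.
Implicit Types (A B C : 'M[int]_n) (D : 'M[rat]_n).

Lemma mulmx_diagE (F : pzRingType) (D A : 'M[F]_n) i j :
  is_diag_mx D -> (D *m A) i j = D i i * A i j.
Proof.
move=> /is_diag_mxP dD; rewrite mxE (bigD1 i) //= big1 ?addr0 // => k neq.
by rewrite dD ?mul0r // eq_sym.
Qed.

Lemma ratmx_skewP D B : is_diag_mx D ->
  reflect (forall i j, D i i * (B i j)%:~R = - (D j j * (B j i)%:~R))
    (D *m ratmx B \is skewmx).
Proof.
move=> dD; apply: (iffP (is_hermitianmxP _ _ _)) => [E i j|E].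
  have := congr1 (fun M : 'M[rat]_n => M i j) E.
  rewrite expr1 scaleN1r mulmx_diagE // mxE [RHS]mxE [in RHS]mxE [in RHS]mxE.
  by rewrite mulmx_diagE // mxE.
apply/matrixP => i j; rewrite expr1 scaleN1r mulmx_diagE // mxE E.
by rewrite [RHS]mxE [in RHS]mxE [in RHS]mxE mulmx_diagE // [in RHS]mxE.
Qed.

Lemma ratmx_symP D C : is_diag_mx D ->
  reflect (forall i j, D i i * (C i j)%:~R = D j j * (C j i)%:~R)
    (D *m ratmx C \is symmetricmx).
Proof.
move=> dD; apply: (iffP (is_hermitianmxP _ _ _)) => [E i j|E].
  have := congr1 (fun M : 'M[rat]_n => M i j) E.
  rewrite expr0 scale1r mulmx_diagE // mxE [RHS]mxE [in RHS]mxE.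
  by rewrite mulmx_diagE // mxE.
apply/matrixP => i j; rewrite expr0 scale1r mulmx_diagE // mxE E.
by rewrite [RHS]mxE [in RHS]mxE mulmx_diagE // [in RHS]mxE.
Qed.

End DiagonalScaling.

Lemma small_expn2_expn3 a : 0 < a <= 3 -> a = 2 ^ (a == 2) * 3 ^ (a == 3).
Proof. by case: a => [|[|[|[|]]]]. Qed.

Section Soundness.
Variables (R : realType) (x y : seq bool) (n : nat).
Hypothesis n_stride : n < stride x.
Hypothesis sym_ok : forall i j, i < n -> j < n -> check_sym x y i j.
Hypothesis row_ok : forall i, i < n -> check_row x y i.
Local Open Scope ring_scope.

Definition scale i : nat := (2 ^ two_exp x y i * 3 ^ three_exp x y i)%N.

Lemma scale_gt0 i : (0 < scale i)%N.
Proof. by rewrite /scale muln_gt0 !expn_gt0. Qed.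

Lemma scale_babs i j : (i < n)%N -> (j < n)%N ->
  (scale i * babs x y i j)%N = (scale j * babs x y j i)%N.
Proof.
move=> lti ltj; move: (sym_ok lti ltj); rewrite /check_sym.
case: ifP => [/andP[/eqP -> /eqP ->] _|_]; first by rewrite !muln0.
move=> /and5P[p q _ _ /andP[/eqP E2 /eqP E3]].
have E := small_expn2_expn3.
rewrite [in LHS](E (babs x y i j)) ?p ?babs_le3 // [in RHS](E (babs x y j i)) ?q ?babs_le3 //.
by rewrite /scale mulnACA -!expnD E2 E3 !expnD mulnACA.
Qed.

Lemma sign_ok i j : (i < n)%N -> (j < n)%N -> babs x y i j != 0%N ->
  bneg x y i j = ~~ bneg x y j i /\ cneg x y i j = cneg x y j i.
Proof.
move=> lti ltj; move: (sym_ok lti ltj); rewrite /check_sym => + nz.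
by rewrite (negPf nz) /= => /and5P[_ _ /eqP -> /eqP ->].
Qed.

Lemma scale_bval i j : (i < n)%N -> (j < n)%N ->
  (scale i)%:Z * bval x y i j = - ((scale j)%:Z * bval x y j i).
Proof.
move=> lti ltj; have E := scale_babs lti ltj; rewrite /bval.
have [z|nz] := eqVneq (babs x y i j) 0%N.
  move: E; rewrite z muln0 => /esym/eqP.
  rewrite muln_eq0 gtn_eqF ?scale_gt0 //= => /eqP ->.
  by rewrite oppr0 !if_same !mulr0 oppr0.
have [-> _] := sign_ok lti ltj nz.
by case: bneg; rewrite /= ?mulrN ?opprK -?PoszM E.
Qed.

Lemma scale_cval i j : (i < n)%N -> (j < n)%N ->
  (scale i)%:Z * cval x y i j = (scale j)%:Z * cval x y j i.
Proof.
move=> lti ltj; have [->//|neq] := eqVneq i j.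
have E := scale_babs lti ltj.
rewrite /cval /cabs [j == i]eq_sym (negPf neq).
have [z|nz] := eqVneq (babs x y i j) 0%N.
  move: E; rewrite z muln0 => /esym/eqP.
  rewrite muln_eq0 gtn_eqF ?scale_gt0 //= => /eqP ->.
  by rewrite oppr0 !if_same !mulr0.
have [_ ->] := sign_ok lti ltj nz.
by case: cneg; rewrite /= ?mulrN -?PoszM E.
Qed.

Definition verified_B : 'M[int]_n := \matrix_(i, j) bval x y i j.
Definition verified_C : 'M[int]_n := \matrix_(i, j) cval x y i j.
Definition verified_D : 'M[rat]_n := diag_mx (\row_i (scale i)%:R).

Lemma verified_DE i : verified_D i i = (scale i)%:R.
Proof. by rewrite !mxE eqxx mulr1n. Qed.

Lemma verified_D_pos : pos_diag_mx verified_D.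
Proof.
split; first exact: diag_mx_is_diag.
by move=> i; rewrite verified_DE ltr0n scale_gt0.
Qed.

Lemma verified_skew : skew_symmetrizable verified_B.
Proof.
exists verified_D; split; first exact: verified_D_pos.
apply/ratmx_skewP; first exact: diag_mx_is_diag.
move=> i j; rewrite !verified_DE !mxE !pmulrn -!intrM.
by rewrite scale_bval // intrN.
Qed.

Lemma verified_symmetrizer : symmetrizer verified_C verified_D.
Proof.
split; first exact: verified_D_pos.
apply/ratmx_symP; first exact: diag_mx_is_diag.
by move=> i j; rewrite !verified_DE !mxE !pmulrn -!intrM scale_cval.
Qed.

Lemma lval_diag_gt0 i : (i < n)%N -> 0 < lval x y i i.
Proof.
move=> lti; move: (row_ok lti) => /and4P[/negPf nneg /hasP[b]].
rewrite mem_iota add0n => /andP[_ ltb] bit _ _.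
rewrite /lval nneg mul1r big_mkord (bigD1 (Ordinal ltb)) //= bit mul1r.
rewrite ltr_pwDl ?exprn_gt0 // sumr_ge0 // => k _.
by rewrite mulr_ge0 // exprn_ge0.
Qed.

Lemma row_sum (i j : 'I_n) :
  \sum_(k < n | (k <= i)%N) lval x y i k * cval x y k j =
  \sum_(0 <= k < i.+1) lval x y i k * cval x y k j.
Proof.
rewrite big_mkord (big_ord_widen n (fun k => lval x y i k * cval x y k j)) //.
Qed.

Lemma verified_positive : positive_mx R verified_C.
Proof.
exists verified_D; split; first exact: verified_symmetrizer.
set A := map_mx _ _.
have AE i j : A i j = (scale i)%:R * (cval x y i j)%:~R.
  rewrite [A i j]mxE mulmx_diagE ?diag_mx_is_diag // verified_DE !mxE.
  by rewrite rmorphM /= ratr_nat ratr_int.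
(* Column [k] is divided by d_k, so that [L *m A] becomes the integer product checked by the
   verifier. *)
pose L : 'M[R]_n := \matrix_(i, k)
  (if (k <= i)%N then (lval x y i k)%:~R / (scale k)%:R else 0).
have sc0 i : (scale i)%:R != 0 :> R by rewrite pnatr_eq0 -lt0n scale_gt0.
have LA i j : (L *m A) i j = (\sum_(0 <= k < i.+1) lval x y i k * cval x y k j)%:~R.
  rewrite -row_sum mxE [in RHS]big_mkcond /= rmorph_sum /=; apply: eq_bigr => k _.
  rewrite AE mxE; case: ifP => _; last by rewrite mul0r.
  by rewrite mulrA divfK // intrM.
apply: (@posdefmx_lower _ _ _ L).
- apply/matrixP => i j; rewrite mxE !AE !pmulrn -!intrM.
  by rewrite scale_cval.
- by move=> i j lt; rewrite mxE leqNgt lt.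
- move=> i; rewrite mxE leqnn divr_gt0 ?ltr0n ?scale_gt0 // ltr0z.
  exact: lval_diag_gt0.
- move=> i j lt; rewrite LA; apply/eqP; rewrite intr_eq0.
  have [<- _] := clamped_sign y j (ltn_trans (ltn_ord i) n_stride).
  have /and4P[_ _ /allP H _] := row_ok (ltn_ord i).
  by apply: H; rewrite mem_iota.
- move=> i; rewrite LA ltr0z.
  have [_ <-] := clamped_sign y i (ltn_trans (ltn_ord i) n_stride).
  by have /and4P[] := row_ok (ltn_ord i).
Qed.

Lemma verified_companion : has_positive_companion R verified_B.
Proof.
exists verified_C; split; last exact: verified_positive.
split=> [|i j neq].
  split=> [|i]; first by exists verified_D; exact: verified_symmetrizer.
  by rewrite mxE /cval /cneg /cabs eqxx.
have neq' : (nat_of_ord i == nat_of_ord j) = false.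
  by apply: contraNF neq => /eqP E; apply/eqP/val_inj.
by rewrite !mxE /cval /bval /cabs neq'; case: cneg; case: bneg; rewrite ?normrN.
Qed.

End Soundness.

Lemma verifier_sound (R : realType) x y :
  verifier x y -> positive_companion_problem R x.
Proof.
move=> /hasP[n]; rewrite mem_iota add0n => /andP[_ lt].
move=> /and4P[n0 w /allP s /allP r].
have Hs i j : i < n -> j < n -> check_sym x y i j.
  move=> lti ltj; have /s /allP H : i \in iota 0 n by rewrite mem_iota.
  by apply: H; rewrite mem_iota.
have Hr i : i < n -> check_row x y i by move=> lti; apply: r; rewrite mem_iota.
exists n, (verified_B x y n); split => //.
- exact: verified_skew.
- exact: verified_companion.
- by apply/eqP; rewrite -check_wordE.
Qed.

(** * Completeness *)

Lemma sum_odd_expn2 m K : m < 2 ^ K -> \sum_(0 <= b < K) odd (m %/ 2 ^ b) * 2 ^ b = m.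
Proof.
elim: K m => [|K IH] m lt; first by rewrite big_geq //; move: lt; case: m.
rewrite big_nat_recl // divn1 muln1 -[RHS]odd_double_half; congr (_ + _).
rewrite -[in RHS](IH m./2); last by rewrite -divn2 ltn_divLR // -expnSr.
rewrite -mul2n big_distrr /=; apply: eq_bigr => b _.
by rewrite expnS divnMA divn2 mulnCA.
Qed.

Lemma sum_ltn_const a s : a <= s -> \sum_(0 <= v < s) (v < a) = a.
Proof.
move=> le; rewrite (@big_cat_nat _ _ _ a) //= big_nat.
rewrite (eq_bigr (fun=> 1)) => [|v /andP[_ ->]] //.
rewrite -big_nat sum_nat_const_nat subn0 muln1.
rewrite big_nat (eq_bigr (fun=> 0)) => [|v /andP[av _]]; last by rewrite ltnNge av.
by rewrite -big_nat big1_eq addn0.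
Qed.

Section Certificate.
Variables (x : seq bool) (g : nat -> nat -> nat -> nat -> bool).
Let s := stride x.

(** Successive division by [s * s], [s] and [s] inverts the addressing of [cert]; there are seven
    tables of [s * s] blocks of [s * s] cells. *)
Definition certificate : seq bool :=
  mkseq (fun p => let q := p %/ (s * s) in
      g (q %/ s %/ s) (q %/ s %% s) (q %% s) (p %% (s * s)))
    (7 * s * s * (s * s)).

Lemma cert_certificate t i j b : t < 7 -> i < s -> j < s -> b < s * s ->
  cert x certificate t i j b = g t i j b.
Proof.
move=> lt7 lti ltj ltb; have s0 : 0 < s by [].
have ss0 : 0 < s * s by [].
have in_range a c u v : a < u -> c < v -> a * v + c < u * v.
  move=> au cv; apply: (@leq_trans (a.+1 * v)); last by rewrite leq_mul2r au orbT.
  by rewrite mulSn addnC ltn_add2r.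
rewrite /cert /certificate -/s nth_mkseq; last first.
  by apply: (in_range) => //; apply: (in_range) => //; apply: (in_range).
cbv zeta; rewrite divnMDl // (divn_small ltb) addn0 [(_ + b) %% _]modnMDl (modn_small ltb).
rewrite divnMDl // (divn_small ltj) addn0 [(_ + j) %% _]modnMDl (modn_small ltj).
by rewrite divnMDl // (divn_small lti) addn0 modnMDl (modn_small lti).
Qed.

End Certificate.

Section Completeness.
Variables (x : seq bool) (n : nat).
Variables (bf cf lf : nat -> nat -> int) (af ef : nat -> nat).
Local Open Scope ring_scope.
Hypothesis n_gt0 : (0 < n)%N.
Hypothesis n_stride : (n < stride x)%N.
Hypothesis xE : x = encode_mx (\matrix_(i < n, j < n) bf i j).
Hypothesis bf_le3 : forall i j, (`|bf i j| <= 3)%N.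
Hypothesis cf_diag : forall i, cf i i = 2.
Hypothesis cf_abs : forall i j, (i < n)%N -> (j < n)%N -> i != j -> `|cf i j|%N = `|bf i j|%N.
Hypothesis af_le : forall i, (i < n)%N -> (af i <= stride x)%N.
Hypothesis ef_le : forall i, (i < n)%N -> (ef i <= stride x)%N.
Hypothesis sym_ok : forall i j, (i < n)%N -> (j < n)%N -> bf i j != 0 ->
  [/\ bf j i != 0, (bf i j < 0) = ~~ (bf j i < 0), (cf i j < 0) = (cf j i < 0),
      (af i + (`|bf i j| == 2) = af j + (`|bf j i| == 2))%N &
      (ef i + (`|bf i j| == 3) = ef j + (`|bf j i| == 3))%N].
Hypothesis lf_small : forall i k, (i < n)%N -> (k <= i)%N -> (`|lf i k| < 2 ^ nlbits x)%N.
Hypothesis lf_diag : forall i, (i < n)%N -> 0 < lf i i.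
Hypothesis lf_lower : forall i j, (i < n)%N -> (j < i)%N ->
  \sum_(0 <= k < i.+1) lf i k * cf k j = 0.
Hypothesis lf_pos : forall i, (i < n)%N -> 0 < \sum_(0 <= k < i.+1) lf i k * cf k i.

Definition table (t i j b : nat) : bool :=
  match t with
  | 0%N => bf i j < 0
  | 1%N => (b < `|bf i j|)%N
  | 2%N => cf i j < 0
  | 3%N => lf i j < 0
  | 4%N => odd (`|lf i j|%N %/ 2 ^ b)
  | 5%N => (j < af i)%N
  | _ => (j < ef i)%N
  end.

Let y := certificate x table.

Let ltn_stride i : (i < n)%N -> (i < stride x)%N.
Proof. by move=> /ltn_trans; apply. Qed.

Let ss_gt3 : (3 < stride x * stride x)%N.
Proof.
have le : (1 < stride x)%N by move: n_gt0 n_stride; lia.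
by apply: (@leq_trans (2 * 2)) => //; apply: leq_mul.
Qed.

Let certE t i j b : (t < 7)%N -> (i < stride x)%N -> (j < stride x)%N ->
  (b < stride x * stride x)%N -> cert x y t i j b = table t i j b.
Proof. exact: cert_certificate. Qed.

Lemma table_bneg i j : (i < n)%N -> (j < n)%N -> bneg x y i j = (bf i j < 0).
Proof. by move=> /ltn_stride lti /ltn_stride ltj; rewrite /bneg certE. Qed.

Lemma table_babs i j : (i < n)%N -> (j < n)%N -> babs x y i j = `|bf i j|%N.
Proof.
move=> /ltn_stride lti /ltn_stride ltj; have := ss_gt3; rewrite /babs => ?.
rewrite !certE //=; try lia.
by have := bf_le3 i j; case: (`|_|)%N => [|[|[|[|]]]].
Qed.

Lemma sign_abs (z : int) : (if z < 0 then - `|z|%N%:Z else `|z|%N%:Z) = z.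
Proof. by case: ltP; lia. Qed.

Lemma table_bval i j : (i < n)%N -> (j < n)%N -> bval x y i j = bf i j.
Proof. by move=> lti ltj; rewrite /bval table_bneg // table_babs // sign_abs. Qed.

Lemma table_cneg i j : (i < n)%N -> (j < n)%N -> cneg x y i j = (cf i j < 0).
Proof.
move=> lti ltj; rewrite /cneg; have [->|neq] /= := eqVneq i j.
  by rewrite cf_diag.
by rewrite certE ?ltn_stride.
Qed.

Lemma table_cval i j : (i < n)%N -> (j < n)%N -> cval x y i j = cf i j.
Proof.
move=> lti ltj; rewrite /cval table_cneg // /cabs.
have [->|neq] := eqVneq i j; first by rewrite cf_diag.
by rewrite table_babs // -cf_abs // sign_abs.
Qed.

Lemma table_lval i k : (i < n)%N -> (k <= i)%N -> lval x y i k = lf i k.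
Proof.
move=> lti lek; have ltk := leq_ltn_trans lek lti.
rewrite /lval /lneg certE ?ltn_stride //=.
transitivity ((if lf i k < 0 then -1 else 1) * (`|lf i k|%N%:Z)); last first.
  by rewrite -[RHS]sign_abs; case: ifP; rewrite ?mulN1r ?mul1r.
congr (_ * _); rewrite -[in RHS](sum_odd_expn2 (lf_small lti lek)).
rewrite (big_morph Posz PoszD (erefl 0%:Z)) !big_nat; apply: eq_bigr => b /andP[_ ltb].
rewrite /lbit certE ?ltn_stride //= PoszM; congr (_ * _).
by rewrite -[Posz (_ ^ _)%N]natz natrX.
Qed.

Lemma table_two_exp i : (i < n)%N -> two_exp x y i = af i.
Proof.
move=> lti; rewrite /two_exp -[RHS](sum_ltn_const (af_le lti)).
rewrite !big_nat; apply: eq_bigr => v /andP[_ ltv].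
by rewrite certE // ltn_stride.
Qed.

Lemma table_three_exp i : (i < n)%N -> three_exp x y i = ef i.
Proof.
move=> lti; rewrite /three_exp -[RHS](sum_ltn_const (ef_le lti)).
rewrite !big_nat; apply: eq_bigr => v /andP[_ ltv].
by rewrite certE // ltn_stride.
Qed.

Lemma table_check_sym i j : (i < n)%N -> (j < n)%N -> check_sym x y i j.
Proof.
move=> lti ltj; rewrite /check_sym !table_babs // !absz_eq0.
have [z|nz] := eqVneq (bf i j) 0.
  have [//|nz'] := eqVneq (bf j i) 0.
  by have [] := sym_ok ltj lti nz'; rewrite z eqxx.
have [nz' E1 E2 E3 E4] := sym_ok lti ltj nz.
rewrite (negPf nz') !absz_gt0 nz nz' !table_bneg // !table_cneg //.
by rewrite !table_two_exp // !table_three_exp // E1 E2 E3 E4 !eqxx.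
Qed.

Lemma table_check_row i : (i < n)%N -> check_row x y i.
Proof.
move=> lti.
have lcE j : (j < n)%N ->
    \sum_(0 <= k < i.+1) lval x y i k * cval x y k j = \sum_(0 <= k < i.+1) lf i k * cf k j.
  move=> ltj; rewrite !big_nat; apply: eq_bigr => k /andP[_ ltk].
  by rewrite table_lval // table_cval // (leq_ltn_trans _ lti).
apply/and4P; split.
- by rewrite /lneg certE ?ltn_stride //= -leNgt ltW // lf_diag.
- have := lf_diag lti; rewrite -(table_lval lti) // /lval.
  apply: contraLR; rewrite -all_predC => /allP H.
  rewrite big_nat big1 ?mulr0 // => b /andP[_ ltb].
  have := H b; rewrite mem_iota => /(_ ltb) /= /negPf ->.
  by rewrite mul0r.
- apply/allP => j; rewrite mem_iota => /= ltj.
  have [-> _] := clamped_sign y j (ltn_stride lti).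
  by rewrite lcE ?lf_lower // (ltn_trans ltj).
- have [_ ->] := clamped_sign y i (ltn_stride lti).
  by rewrite lcE // lf_pos.
Qed.

Lemma table_verifier : verifier x y.
Proof.
apply/hasP; exists n; first by rewrite mem_iota.
apply/and4P; split => //.
- rewrite check_wordE {1}xE; apply/eqP; congr encode_mx.
  by apply/matrixP => i j; rewrite !mxE table_bval.
- apply/allP => i; rewrite mem_iota => /= lti; apply/allP => j.
  by rewrite mem_iota => /= ltj; apply: table_check_sym.
- by apply/allP => i; rewrite mem_iota => /= lti; apply: table_check_row.
Qed.

Lemma verifier_complete : exists z, (size z <= 7 * stride x ^ 4)%N /\ verifier x z.
Proof.
exists y; split; last exact: table_verifier.
by rewrite size_mkseq !expnS expn0 muln1 !mulnA.
Qed.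

End Completeness.

(** * Entry bounds and elimination rows of a positive companion *)

Lemma absz_det_le (m : nat) (M : 'M[int]_m) (c : nat) :
  (forall i j, absz (M i j) <= c) -> absz (\det M)%R <= m`! * c ^ m.
Proof.
move=> le; rewrite -lez_nat abszE /determinant.
apply: (le_trans (ler_norm_sum _ _ _)).
apply: (@le_trans _ _ (\sum_(s : {perm 'I_m}) Posz (c ^ m))%R); last first.
  by rewrite sumr_const card_Sn -mulr_natl natz -PoszM.
apply: ler_sum => s _; rewrite normrM normrX normrN1 expr1n mul1r normr_prod.
apply: (@le_trans _ _ (\prod_(i < m) Posz c)%R).
  by apply: ler_prod => i _; rewrite normr_ge0 -abszE lez_nat le.
by rewrite prodr_const card_ord -[Posz c]natz -natrX natz.
Qed.

Lemma fact_le_expn2 m : m`! <= 2 ^ (m * m).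
Proof.
elim: m => // m IH; rewrite factS.
apply: (@leq_trans (2 ^ m.+1 * 2 ^ (m * m))).
  by rewrite leq_mul // ltnW // ltn_expl.
by rewrite -expnD leq_exp2l //; lia.
Qed.

Section PositiveCompanion.
Variables (R : realType) (n : nat) (C : 'M[int]_n) (D : 'M[rat]_n).
Hypothesis symD : symmetrizer C D.
Hypothesis posC : posdefmx (map_mx (ratr : rat -> R) (D *m ratmx C)).
Hypothesis diagC : forall i, C i i = 2%R.
Local Open Scope ring_scope.

Let diagD : is_diag_mx D := symD.1.1.
Let D_gt0 i : 0 < D i i := symD.1.2 i.

Lemma companion_sym i j : D i i * (C i j)%:~R = D j j * (C j i)%:~R.
Proof. by have /(ratmx_symP _ diagD) := symD.2. Qed.

(* The sum is the value of the form [D C] at [u D^-1]. *)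
Lemma companion_form_gt0 (u : 'rV[int]_n) : u != 0 ->
  0 < \sum_j ((u *m C) 0 j * u 0 j)%:~R / D j j.
Proof.
move=> u0; pose w : 'cV[R]_n := \col_i ratr ((u 0 i)%:~R / D i i).
have w0 : w != 0.
  apply: contra_neq u0 => /matrixP w0; apply/matrixP => a i; rewrite ord1 [RHS]mxE.
  have := w0 i 0; rewrite !mxE => /eqP; rewrite fmorph_eq0 mulf_eq0 invr_eq0.
  by rewrite (gt_eqF (D_gt0 i)) orbF intr_eq0 => /eqP.
have := posC w0; rewrite mxE.
rewrite (eq_bigr (fun j => ratr (((u *m C) 0 j * u 0 j)%:~R / D j j))).
  by rewrite -rmorph_sum ltr0q.
move=> j _; rewrite [w _ _]mxE intrM -mulrA [RHS]rmorphM /=; congr (_ * _).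
rewrite mxE [in RHS]mxE !rmorph_sum /=; apply: eq_bigr => k _.
rewrite [w^T _ _]mxE [w _ _]mxE [map_mx _ _ _ _]mxE mulmx_diagE // [ratmx _ _ _]mxE.
by rewrite -rmorphM /= mulrA divfK ?gt_eqF // intrM.
Qed.

(** The form is evaluated at u = 2 e_j - c_ji e_i, for which u C vanishes at index i; what remains
    is a positive multiple of 4 - c_ij c_ji. *)
Lemma companion_prod_lt4 i j : i != j -> C i j * C j i < 4.
Proof.
move=> neq; pose u : 'rV[int]_n :=
  \row_k (if k == i then - C j i else if k == j then 2 else 0).
have ui : u 0 i = - C j i by rewrite mxE eqxx.
have uj : u 0 j = 2 by rewrite mxE eq_sym (negPf neq) eqxx.
have uk k : k != i -> k != j -> u 0 k = 0.
  by move=> ki kj; rewrite mxE (negPf ki) (negPf kj).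
have uC k : (u *m C) 0 k = - C j i * C i k + 2 * C j k.
  rewrite mxE (bigD1 i) //= (bigD1 j) 1?eq_sym //= ui uj big1 ?addr0 // => l /andP[li lj].
  by rewrite uk ?mul0r.
have u0 : u != 0.
  by apply/eqP => /matrixP /(_ 0 j); rewrite uj mxE.
have := companion_form_gt0 u0.
rewrite (bigD1 j) //= big1 => [|k kj]; last first.
  have [->|ki] := eqVneq k i; last by rewrite uk // mulr0 mul0r.
  have z : - C j i * 2 + 2 * C j i = 0 by ring.
  by rewrite uC diagC z !mul0r.
rewrite addr0 uC uj diagC pmulr_lgt0 ?invr_gt0 // ltr0z; move: (C i j) (C j i) => a b.
lia.
Qed.

(** If c_ij is nonzero then c_ij c_ji is positive, since d_j times it equals d_i c_ij^2. A positive
    integer product below 4 bounds both factors by 3 in absolute value. *)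
Lemma companion_entries_le3 i j : i != j -> (`|C i j| <= 3)%N.
Proof.
move=> neq; have E := companion_sym i j; have := companion_prod_lt4 neq.
have [->//|nz] := eqVneq (C i j) 0.
have : 0 < C i j * C j i.
  have : 0 < (C i j * C j i)%:~R * D j j :> rat.
    have -> : (C i j * C j i)%:~R * D j j = D i i * (C i j)%:~R ^+ 2.
      by rewrite intrM -mulrA [_ * D j j]mulrC -E mulrCA expr2.
    by rewrite mulr_gt0 // exprn_even_gt0 //= intr_eq0.
  by rewrite pmulr_lgt0 // ltr0z.
move: (C i j) (C j i) nz {E} => a b nz p q.
have [a0|a0] := ltP 0 a.
  have b0 : 0 < b by move: p; rewrite pmulr_rgt0.
  have : a <= a * b by apply: ler_peMr; [exact: ltW|rewrite -gtz0_ge1].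
  lia.
have {}a0 : a < 0 by rewrite lt_neqAle nz.
have b0 : b < 0 by move: p; rewrite nmulr_rgt0.
have : - a <= - a * - b by apply: ler_peMr; [rewrite oppr_ge0 ltW|rewrite -gtz0_ge1 oppr_gt0].
rewrite mulrNN; lia.
Qed.

Section LeadingMinor.
Variable i : 'I_n.
Let emb : 'I_i.+1 -> 'I_n := widen_ord (ltn_ord i).
Let S : 'M[int]_i.+1 := mxsub emb emb C.

(** A vector on the leading indices is extended by zero. *)
Lemma leading_form_gt0 (v : 'rV[int]_i.+1) : v != 0 ->
  0 < \sum_b ((v *m S) 0 b * v 0 b)%:~R / D (emb b) (emb b).
Proof.
move=> v0; pose u : 'rV[int]_n :=
  \row_k (if insub (k : nat) is Some a then v 0 a else 0).
have uE a : u 0 (emb a) = v 0 a.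
  by rewrite mxE insubT //= => lt; congr (v _ _); apply: val_inj.
have u_out (k : 'I_n) : (k < i.+1)%N = false -> u 0 k = 0.
  by move=> ge; rewrite mxE insubF.
have uC j : (u *m C) 0 j = \sum_a v 0 a * C (emb a) j.
  rewrite mxE (bigID (fun k : 'I_n => (k < i.+1)%N)) /= [X in _ + X]big1 ?addr0.
    by rewrite (big_ord_narrow (ltn_ord i)); apply: eq_bigr => a _; rewrite uE.
  by move=> k /negbTE ge; rewrite u_out ?mul0r.
have u0 : u != 0.
  apply: contra_neq v0 => u0; apply/matrixP => z a.
  by rewrite ord1 -uE u0 !mxE.
have := companion_form_gt0 u0.
rewrite (bigID (fun k : 'I_n => (k < i.+1)%N)) /= [X in _ + X]big1 ?addr0; last first.
  by move=> k /negbTE ge; rewrite u_out ?mulr0 ?mul0r.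
rewrite (big_ord_narrow (ltn_ord i)); congr (_ < _); apply: eq_bigr => b _.
rewrite -/emb uE uC; congr ((_ * _)%:~R / _).
by rewrite mxE; apply: eq_bigr => a _; rewrite mxE.
Qed.

(** A nonzero vector in the left kernel would be a zero of the form. *)
Lemma leading_det_neq0 : \det S != 0.
Proof.
apply/negP => /det0P[v v0 vS]; have := leading_form_gt0 v0.
by rewrite vS big1 ?ltxx // => b _; rewrite mxE mul0r mul0r.
Qed.

(* Up to sign, the last row of the adjugate of the leading principal submatrix. *)
Lemma exists_elimination_row : exists l : 'I_n -> int,
  [/\ 0 < l i, forall j : 'I_n, (j < i)%N -> \sum_(k < n | (k < i.+1)%N) l k * C k j = 0,
      0 < \sum_(k < n | (k < i.+1)%N) l k * C k i &
      forall k, (`|l k| <= i`! * 3 ^ i)%N].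
Proof.
pose v := row ord_max (\adj S).
have vS b : (v *m S) 0 b = \det S *+ (ord_max == b).
  by rewrite -row_mul mul_adj_mx !mxE.
have v0 : v != 0.
  apply: contra_neq leading_det_neq0 => v0.
  by have := vS ord_max; rewrite v0 mul0mx mxE eqxx.
have emax : emb ord_max = i by apply: val_inj.
(* At [v] only the last term of the form survives, so the last entry of [v] has the sign of the
   determinant. *)
have detv : 0 < \det S * v 0 ord_max.
  have := leading_form_gt0 v0; rewrite (bigD1 ord_max) //= big1 ?addr0.
    by rewrite vS eqxx mulr1n pmulr_lgt0 ?invr_gt0 // ltr0z.
  by move=> b neq; rewrite vS eq_sym (negPf neq) mulr0n mul0r mul0r.
have {}detv : 0 < \det S /\ 0 < v 0 ord_max \/ \det S < 0 /\ v 0 ord_max < 0.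
  move: detv; case: (ltgtP (v 0 ord_max) 0) => [z0|z0|->].
  - by rewrite nmulr_lgt0 // => d0; right.
  - by rewrite pmulr_lgt0 // => d0; left.
  - by rewrite mulr0 ltxx.
(* This sign makes the diagonal entry of the row positive, and with it [e * \det S]. *)
pose e : int := if v 0 ord_max < 0 then -1 else 1.
pose l (k : 'I_n) : int := if insub (k : nat) is Some a then e * v 0 a else 0.
have lE a : l (emb a) = e * v 0 a.
  by rewrite /l insubT //= => lt; congr (_ * v _ _); apply: val_inj.
have sumE b : \sum_(k < n | (k < i.+1)%N) l k * C k (emb b) = e * (\det S *+ (ord_max == b)).
  rewrite (big_ord_narrow (ltn_ord i)) -vS mxE mulr_sumr; apply: eq_bigr => a _.
  by rewrite -/emb lE [S a b]mxE mulrA.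
exists l; split.
- rewrite -emax lE /e; move: detv; move: (v 0 _) => z; move: (\det S) => d.
  by case: (ltP z 0); lia.
- move=> j lt; have jE : j = emb (Ordinal (leq_trans lt (leqnSn i))) by apply: val_inj.
  rewrite jE sumE; case: eqP => [/(congr1 val) /= E|_]; last by rewrite mulr0.
  by exfalso; move: (lt); rewrite -E ltnn.
- rewrite -emax sumE eqxx /e; move: detv; move: (v 0 _) => z; move: (\det S) => d.
  by case: (ltP z 0); lia.
- move=> k; rewrite /l; case: insubP => [a _ _|_]; last by rewrite absz0.
  have -> : absz (e * v 0 a) = absz (v 0 a) by rewrite abszM /e; case: ifP; rewrite mul1n.
  (* Each entry is up to sign an [i] by [i] minor, built from diagonal entries 2 and others of
     absolute value at most 3. *)
  rewrite !mxE /cofactor abszM abszX exp1n ?mul1n.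
  apply: absz_det_le => p q; rewrite !mxE.
  have [->|neq] := eqVneq (emb (lift a p)) (emb (lift ord_max q)); first by rewrite diagC.
  exact: companion_entries_le3.
Qed.

End LeadingMinor.
End PositiveCompanion.

(** * Exponents of the skew-symmetrizer *)

Lemma expn2_expn3_inj a b c d : 2 ^ a * 3 ^ b = 2 ^ c * 3 ^ d -> a = c /\ b = d.
Proof.
have l2 u v : logn 2 (2 ^ u * 3 ^ v) = u.
  by rewrite lognM ?expn_gt0 // pfactorK // lognX muln0 addn0.
have l3 u v : logn 3 (2 ^ u * 3 ^ v) = v.
  by rewrite lognM ?expn_gt0 // pfactorK // lognX muln0.
by move=> E; split; [rewrite -(l2 a b) E l2|rewrite -(l3 a b) E l3].
Qed.

Section Exponents.
Variables (n : nat) (B : 'M[int]_n) (d : 'I_n -> rat).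
Local Open Scope ring_scope.
Let b i j : nat := absz (B i j).
Hypothesis d_gt0 : forall i, 0 < d i.
Hypothesis d_sym : forall i j, d i * (b i j)%:R = d j * (b j i)%:R.
Hypothesis b_le3 : forall i j, (b i j <= 3)%N.

Let edge : rel 'I_n := fun i j => b i j != 0%N.

Let edge_sym : symmetric edge.
Proof.
move=> i j; apply/idP/idP; apply: contraNN => /eqP z; have := d_sym i j;
  rewrite z mulr0.
  by move/eqP; rewrite mulf_eq0 gt_eqF //= pnatr_eq0.
by move/esym/eqP; rewrite mulf_eq0 gt_eqF //= pnatr_eq0.
Qed.

Let bE i j : edge i j -> b i j = (2 ^ (b i j == 2) * 3 ^ (b i j == 3))%N.
Proof. by move=> e; apply: small_expn2_expn3; rewrite lt0n b_le3 andbT. Qed.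

(** Along an edge from r to k, d_k = d_r |b_rk| / |b_kr|, so each exponent changes by at most 1. A
    factor 6 per edge keeps the exponents natural and lets them grow by at most 2. *)
Lemma path_exponents r p : path edge r p -> exists a c,
  [/\ (a <= 2 * size p)%N, (c <= 2 * size p)%N &
      d (last r p) * (2 ^ size p * 3 ^ size p)%N%:R = d r * (2 ^ a * 3 ^ c)%N%:R].
Proof.
elim: p r => [|k p IH] r /=; first by exists 0%N, 0%N.
move=> /andP[e /IH[a [c [la lc E]]]].
have e' : edge k r by rewrite edge_sym.
exists (a + 1 + (b r k == 2) - (b k r == 2))%N, (c + 1 + (b r k == 3) - (b k r == 3))%N.
split; [by lia|by lia|].
have nz : (b k r)%:R != 0 :> rat by rewrite pnatr_eq0.
apply: (mulIf nz); rewrite -[RHS]mulrA -natrM.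
have -> : (2 ^ (a + 1 + (b r k == 2) - (b k r == 2)) *
    3 ^ (c + 1 + (b r k == 3) - (b k r == 3)) * b k r =
    b r k * (2 ^ a * 3 ^ c * 6))%N.
  rewrite [X in (_ * X = _)%N](bE e') [in RHS](bE e) mulnACA -!expnD.
  rewrite !subnK; try lia.
  by rewrite !expnD !expn1; lia.
rewrite [in RHS]natrM [RHS]mulrA d_sym [RHS]mulrAC; congr (_ * _).
rewrite [in RHS]natrM [RHS]mulrA -E -mulrA -natrM.
by congr (_ * _%:R); rewrite !expnS; lia.
Qed.

(** Exponents are taken relative to the root of the connected component, after scaling by 6^n.
    Adjacent vertices share the root, so its [d] cancels and unique factorization yields the
    equations. *)
Lemma exists_exponents : exists (al be : 'I_n -> nat),
  (forall i, (al i <= 2 * n)%N /\ (be i <= 2 * n)%N) /\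
  forall i j, B i j != 0 ->
    (al i + (b i j == 2) = al j + (b j i == 2))%N /\
    (be i + (b i j == 3) = be j + (b j i == 3))%N.
Proof.
have csym := sym_connect_sym edge_sym.
have H i : exists ac : nat * nat, [/\ (ac.1 <= 2 * n)%N, (ac.2 <= 2 * n)%N &
    d i * (2 ^ n * 3 ^ n)%N%:R = d (fingraph.root edge i) * (2 ^ ac.1 * 3 ^ ac.2)%N%:R].
  have : connect edge (fingraph.root edge i) i by rewrite csym connect_root.
  move=> /connectP[p0 path_p0 E0].
  (* A simple path has fewer than [n] edges. *)
  case/shortenP: path_p0 E0 => p path_p uniq_p _ lastE.
  have [a [c [la lc E]]] := path_exponents path_p.
  set l := size p in la lc E.
  have sz : (l <= n)%N.
    have := max_card (mem (fingraph.root edge i :: p)); rewrite (card_uniqP uniq_p) card_ord /=.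
    exact: ltnW.
  (* Path lengths differ; adding [n - l] to both exponents reaches the common factor 6^n. *)
  clearbody l; exists (a + (n - l), c + (n - l))%N; split => /=; try lia.
  rewrite !expnD mulnACA [in RHS]natrM [RHS]mulrA -E -lastE -mulrA -natrM.
  by rewrite mulnACA -!expnD subnKC.
have [f Hf] := choice H.
exists (fun i => (f i).1), (fun i => (f i).2); split=> [i|i j nz]; first by case: (Hf i).
have e : edge i j by rewrite /edge absz_eq0.
have e' : edge j i by rewrite edge_sym.
have [_ _ Ei] := Hf i; have [_ _ Ej] := Hf j.
have rE : fingraph.root edge j = fingraph.root edge i.
  by apply/eqP; rewrite root_connect // connect1.
apply: expn2_expn3_inj; rewrite !expnD [LHS]mulnACA [RHS]mulnACA -!bE //.
apply/eqP; rewrite -(eqr_nat rat); apply/eqP.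
apply: (mulfI (lt0r_neq0 (d_gt0 (fingraph.root edge i)))).
rewrite ![(_ * b _ _)%N%:R]natrM ![_ * (_ * _)]mulrA -Ei -[in RHS]rE -Ej.
by rewrite mulrAC d_sym mulrAC.
Qed.

End Exponents.

(** Each entry takes at least two letters, the sign and the end mark. *)
Lemma encode_mx_size n (f : nat -> nat -> int) :
  2 * (n * n) <= size (encode_mx (\matrix_(i < n, j < n) f i j)%R).
Proof.
rewrite encode_mxE size_cat size_flatten_iota.
apply: (@leq_trans (\sum_(0 <= i < n) \sum_(0 <= j < n) 2)).
  by rewrite !sum_nat_const_nat !subn0 mulnC mulnA.
apply: leq_trans (leq_addl _ _); apply: leq_sum => i _.
rewrite size_flatten_iota; apply: leq_sum => j _.
by rewrite /encode_int /encode_nat /= size_cat addn1.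
Qed.

(** The exponents of 2 add up to i^2 + 2 i < (i + 1)^2 <= s^2, using 3 <= 4. *)
Lemma fact_expn3_lt i s : i < s -> i`! * 3 ^ i < 2 ^ (s * s).
Proof.
move=> lt; apply: (@leq_ltn_trans (2 ^ (i * i) * 2 ^ (2 * i))).
  by rewrite leq_mul ?fact_le_expn2 // expnM leq_expl.
by rewrite -expnD ltn_exp2l //; nia.
Qed.

(** * Construction of the certificate *)

Section Witness.
Variables (R : realType) (n' : nat).
Let n := n'.+1.
Variables (B C : 'M[int]_n).
Local Open Scope ring_scope.

(** The exponents come from the skew-symmetrizer of B, the rows of L from the positive form of C;
    [inord] extends all tables to natural indices. *)
Lemma positive_companion_verifier : skew_symmetrizable B ->
  quasi_cartan_companion B C -> positive_mx R C ->
  exists y, (size y <= 7 * stride (encode_mx B) ^ 4)%N /\ verifier (encode_mx B) y.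
Proof.
move=> [D0 [[diag0 pos0] skew0]] [[_ diagC] absC] [D [symD posC]].
have skewB i j : D0 i i * (B i j)%:~R = - (D0 j j * (B j i)%:~R).
  by have /(ratmx_skewP _ diag0) := skew0.
have diagB i : B i i = 0.
  apply/eqP; have /eqP := skewB i i; rewrite -addr_eq0 -mulr2n mulrn_eq0 /=.
  by rewrite mulf_eq0 (gt_eqF (pos0 i)) /= intr_eq0.
have absB i j : i != j -> absz (B i j) = absz (C i j).
  by move=> /absC; rewrite -!abszE => -[].
have le3 i j : (`|B i j| <= 3)%N.
  have [->|neq] := eqVneq i j; first by rewrite diagB.
  by rewrite absB //; apply: (companion_entries_le3 symD posC diagC).
have absD i j : D0 i i * (absz (B i j))%:R = D0 j j * (absz (B j i))%:R.
  have E k l : D0 k k * (absz (B k l))%:R = `|D0 k k * (B k l)%:~R|.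
    by rewrite normrM (gtr0_norm (pos0 k)) -intr_norm -abszE -pmulrn.
  by rewrite !E skewB normrN.
have [al [be [albe_le albe]]] := exists_exponents (fun i => pos0 i) absD le3.
have [L HL] := choice (exists_elimination_row symD posC diagC).
pose bf i j := B (inord i) (inord j).
pose cf i j := C (inord i) (inord j).
pose lf i j := L (inord i) (inord j).
have xE : encode_mx B = encode_mx (\matrix_(i < n, j < n) bf i j).
  by congr encode_mx; apply/matrixP => i j; rewrite mxE /bf !inord_val.
(* From 2 n <= 2 n^2; the factor 2 leaves room for exponents up to 2 n. *)
have size_x : (2 * n < stride (encode_mx B))%N.
  rewrite /stride ltnS xE; apply: leq_trans (encode_mx_size _ _).
  by rewrite leq_mul2l leq_pmulr.
have lt_n : (n < stride (encode_mx B))%N by lia.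
have row_sumE i j : (i < n)%N -> \sum_(0 <= k < i.+1) lf i k * cf k j =
    \sum_(k < n | (k < (inord i : 'I_n).+1)%N) L (inord i) k * C k (inord j).
  move=> lti; rewrite inordK // big_mkord.
  rewrite (big_ord_widen n (fun k => lf i k * cf k j)) //.
  by apply: eq_bigr => k _; rewrite /lf /cf inord_val.
apply: (@verifier_complete _ n bf cf lf (fun i => al (inord i)) (fun i => be (inord i))) => //.
- by move=> i j; apply: le3.
- by move=> i; rewrite /cf diagC.
- move=> i j lti ltj neq; rewrite /cf /bf absB //.
  by apply: contra_neq neq => /(congr1 val); rewrite /= !inordK.
- by move=> i _; have [le _] := albe_le (inord i); lia.
- by move=> i _; have [_ le] := albe_le (inord i); lia.
- move=> i j _ _; rewrite /bf /cf; move: (inord i) (inord j) => {}i {}j nz.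
  have [E1 E2] := albe _ _ nz.
  have neq : i != j by apply: contraNneq nz => ->; rewrite diagB.
  have skew := skewB i j; have csym := companion_sym symD i j.
  have nz' : B j i != 0.
    apply: contra_neq nz => z; move: skew; rewrite z mulr0 oppr0 => /eqP.
    by rewrite mulf_eq0 (gt_eqF (pos0 i)) /= intr_eq0 => /eqP.
  split=> //.
    (* Signs are compared across the equation; the diagonal factors are positive. *)
    have := congr1 (fun z => z < 0) skew.
    rewrite pmulr_rlt0 // oppr_lt0 pmulr_rgt0 // ltrz0 ltr0z => ->.
    by rewrite -leNgt le_eqVlt eq_sym (negPf nz').
  have := congr1 (fun z => z < 0) csym.
  by rewrite !pmulr_rlt0 ?ltrz0 ?(symD.1.2).
- move=> i k lti _; have [_ _ _ le] := HL (inord i).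
  apply: leq_ltn_trans (le _) _; rewrite inordK //.
  by apply: fact_expn3_lt; apply: ltn_trans lti lt_n.
- by move=> i lti; have [] := HL (inord i).
- move=> i j lti ltj; rewrite row_sumE //; have [_ z _ _] := HL (inord i).
  by apply: z; rewrite !inordK // (ltn_trans ltj).
- by move=> i lti; rewrite row_sumE //; have [] := HL (inord i).
Qed.

End Witness.

Theorem mainTheorem2 (R : realType) : in_NP (positive_companion_problem R).
Proof.
(* Certificate length: seven tables of [stride x ^ 4] cells each. *)
exists verifier, (7%:P * ('X + 1%:P) ^+ 4)%R; split; first exact: polytime_verifier.
move=> x; split=> [[[|n] [B [// _ skewB [C [compC posC]] ->]]]|[y [_ /verifier_sound//]]].
have [y [le V]] := positive_companion_verifier skewB compC posC.
exists y; split => //; move: le; rewrite /stride -[(size _).+1]addn1.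
by rewrite hornerM hornerC horner_exp hornerD hornerX hornerC.
Qed.
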